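(* If there are no points conjugate to $a$ in $(a,b]$, then the functional $\mathcal{Q}$ is positive definite, that is, $\mathcal{Q}[h]\ge0$ for every smooth $h:[a,b]\to\mathbb{R}^n$ with $h^{(j)}(a)=h^{(j)}(b)=0$ for $0\le j\le k-1$, and $\mathcal{Q}[h]=0$ only when $h\equiv0$.
   Context: Let $a<b$ be real and $k,n\ge1$. Let $M_{ii}$ ($0\le i\le k$) and $M_{i(i+1)}$ ($0\le i\le k-1$) be smooth functions $[a,b]\to\mathbb{R}^{n\times n}$ with every $M_{ii}(t)$ symmetric and $M_{kk}(t)$ positive definite for all $t$ (strong Legendre condition). Put $$L(t,q_0,\dots,q_k)=\tfrac12\sum_{i=0}^kq_i^{\top}M_{ii}(t)q_i+\sum_{i=0}^{k-1}q_i^{\top}M_{i(i+1)}(t)q_{i+1},\qquad \mathcal{Q}[h]=\int_a^bL(t,h,\dot h,\dots,h^{(k)})\,dt .$$ The Jacobi (Euler-Lagrange) equation of $\mathcal{Q}$ is $\sum_{j=0}^k(-1)^j\frac{d^j}{dt^j}\Big(\frac{\partial L}{\partial q_j}(t,h,\dots,h^{(k)})\Big)=0$, a linear ODE of order $2k$ for $h:[a,b]\to\mathbb{R}^n$. Let $h_1,\dots,h_{kn}$ be linearly independent solutions of the Jacobi equation with $h_i^{(j)}(a)=0$ for $1\le i\le kn$, $0\le j\le k-1$, and let $W[h_1,\dots,h_{kn}](t)$ be the determinant of the $kn\times kn$ matrix whose $i$-th row is $(h_i^{\top}(t),\dot h_i^{\top}(t),\dots,(h_i^{(k-1)})^{\top}(t))$.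 A point $t^\ast\in(a,b]$ is conjugate to $a$ if $W[h_1,\dots,h_{kn}](t^\ast)=0$. *)

(* Defs.v *)
From HB Require Import structures.
From mathcomp Require Import all_boot all_order all_algebra.
From mathcomp Require Import all_classical all_reals all_analysis.

Set Implicit Arguments.
Unset Strict Implicit.
Unset Printing Implicit Defensive.

Import Order.TTheory GRing.Theory Num.Theory.
Import numFieldNormedType.Exports.

Local Open Scope classical_set_scope.
Local Open Scope ring_scope.

(* A function on [a, b] is a total function on R of which only the values on
   [a, b] are used: derivatives are limits of difference quotients within
   [a, b], hence one-sided at a and b.  Outside [a, b] they are junk. *)

Definition diff_quotient (R : realType) (V : normedModType R)
    (f : R -> V) (t s : R) : V :=
  (s - t)^-1 *: (f s - f t).

Definition derivable_seg (R : realType) (V : normedModType R) (a b : R)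
    (f : R -> V) (t : R) : Prop :=
  cvg (diff_quotient f t @ within `[a, b] t^').

Definition deriv_seg (R : realType) (V : normedModType R) (a b : R)
    (f : R -> V) (t : R) : V :=
  lim (diff_quotient f t @ within `[a, b] t^').

Definition derivn_seg (R : realType) (V : normedModType R) (a b : R)
    (j : nat) (f : R -> V) : R -> V :=
  iter j (deriv_seg a b) f.

Definition derivablen_seg (R : realType) (V : normedModType R) (a b : R)
    (m : nat) (f : R -> V) : Prop :=
  forall j t, (j < m)%N -> a <= t <= b ->
    derivable_seg a b (derivn_seg a b j f) t.

Definition smooth_seg (R : realType) (V : normedModType R) (a b : R)
    (f : R -> V) : Prop :=
  forall m, derivablen_seg a b m f.

Definition posdefmx (R : realType) (n : nat) (A : 'M[R]_n) : Prop :=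
  forall v : 'cV[R]_n, v != 0 -> 0 < (v^T *m A *m v) 0 0.

(* Mdiag i is M_{ii}; Moff i is M_{i(i+1)}, where widen_ord and lift ord0 send
   i : 'I_k to the indices i and i+1 in 'I_k.+1. *)
Definition lagrangian (R : realType) (k n : nat)
    (Mdiag : 'I_k.+1 -> R -> 'M[R]_n) (Moff : 'I_k -> R -> 'M[R]_n)
    (t : R) (q : 'I_k.+1 -> 'cV[R]_n) : R :=
  2^-1 * (\sum_(i < k.+1) ((q i)^T *m Mdiag i t *m q i) 0 0)
  + \sum_(i < k)
      ((q (widen_ord (leqnSn k) i))^T *m Moff i t *m q (lift ord0 i)) 0 0.

Definition jet (R : realType) (k n : nat) (a b : R) (h : R -> 'cV[R]_n)
    (t : R) : 'I_k.+1 -> 'cV[R]_n :=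
  fun i => derivn_seg a b i h t.

Definition functionalQ (R : realType) (k n : nat) (a b : R)
    (Mdiag : 'I_k.+1 -> R -> 'M[R]_n) (Moff : 'I_k -> R -> 'M[R]_n)
    (h : R -> 'cV[R]_n) : R :=
  \int[lebesgue_measure]_(t in `[a, b])
    lagrangian Mdiag Moff t (jet a b h t).

(* The gradient, as a column vector, of L with respect to its j-th vector
   argument q_j. *)
Definition grad_arg (R : realType) (k n : nat)
    (L : ('I_k.+1 -> 'cV[R]_n) -> R) (j : 'I_k.+1)
    (q : 'I_k.+1 -> 'cV[R]_n) : 'cV[R]_n :=
  \col_(l < n)
    derive1
      (fun e : R =>
         L (fun i => if i == j then q i + e *: delta_mx l 0 else q i)) 0.

Definition jacobi_solution (R : realType) (k n : nat) (a b : R)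
    (Mdiag : 'I_k.+1 -> R -> 'M[R]_n) (Moff : 'I_k -> R -> 'M[R]_n)
    (h : R -> 'cV[R]_n) : Prop :=
  derivablen_seg a b (2 * k) h /\
  forall t, a <= t <= b ->
    \sum_(j < k.+1) (-1) ^+ j *:
      derivn_seg a b j
        (fun s => grad_arg (lagrangian Mdiag Moff s) j (jet a b h s)) t = 0.

Definition lin_indep_seg (R : realType) (m n : nat) (a b : R)
    (hs : 'I_m -> R -> 'cV[R]_n) : Prop :=
  forall c : 'I_m -> R,
    (forall t, a <= t <= b -> \sum_(i < m) c i *: hs i t = 0) ->
    forall i, c i = 0.

(* mxvec concatenates the rows h^T, h'^T, ..., (h^(k-1))^T. *)
Definition wronskian (R : realType) (k n : nat) (a b : R)
    (hs : 'I_(k * n) -> R -> 'cV[R]_n) (t : R) : R :=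
  \det (\matrix_(i < k * n)
          mxvec (\matrix_(j < k) (derivn_seg a b j (hs i) t)^T)).

Definition conjugate_point (R : realType) (k n : nat) (a b : R)
    (hs : 'I_(k * n) -> R -> 'cV[R]_n) (t : R) : Prop :=
  a < t <= b /\ wronskian a b hs t = 0.

Definition admissible (R : realType) (k n : nat) (a b : R)
    (h : R -> 'cV[R]_n) : Prop :=
  smooth_seg a b h /\
  forall j, (j < k)%N ->
    derivn_seg a b j h a = 0 /\ derivn_seg a b j h b = 0.

Definition positive_definiteQ (R : realType) (k n : nat) (a b : R)
    (Mdiag : 'I_k.+1 -> R -> 'M[R]_n) (Moff : 'I_k -> R -> 'M[R]_n) : Prop :=
  forall h : R -> 'cV[R]_n, admissible k a b h ->
    0 <= functionalQ a b Mdiag Moff h /\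
    (functionalQ a b Mdiag Moff h = 0 -> forall t, a <= t <= b -> h t = 0).

(* Main.v *)
Require Import Defs.
From mathcomp Require Import all_boot all_order all_algebra.
From mathcomp Require Import all_classical all_reals all_analysis.
From mathcomp Require Import ring lra.
Import Order.TTheory GRing.Theory Num.Theory.
Import numFieldNormedType.Exports.
Local Open Scope classical_set_scope.
Local Open Scope ring_scope.

Set Implicit Arguments.
Unset Strict Implicit.
Unset Printing Implicit Defensive.

(** Write [B_t] for the polar form of the quadratic form [L t], and attach to a
    Jacobi solution [g] its momenta [p_0, ..., p_k], where
    [p_j = \sum_(l >= j) (-1)^(l-j) D^(l-j) (dL/dq_l)].  The Jacobi equation says
    [p_0 = 0], and [p_(j+1)' = dL/dq_j - p_j], so that for every curve [u] the
    pairing [K_g u = \sum_(j < k) p_(j+1) . u^(j)] has derivative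
    [B_t (jet g) (jet u)] ([momentum_pairing_has_deriv]).  Since [B_t] is
    symmetric and all [h_i] have zero [(k-1)]-jet at [a], the matrix
    [K_(h_i) h_j] is symmetric ([pairing_hs_sym]).

    Let [h] be admissible.  On [(a, b]] the Wronskian matrix is invertible and the
    [(k-1)]-jet of [h] is a combination [c_1, ..., c_kn] of those of the [h_i],
    with coefficients depending on [t].  Put [A = 1/2 \sum_i c_i K_(h_i) h], the
    Weierstrass-Hilbert action of the field of extremals.  Completing the square
    gives [L = A' + 1/2 v^T M_kk v] with [v = h^(k) - \sum_i c_i h_i^(k)]
    ([field_action_has_deriv]).  So, with [F] a primitive of [L] along [h], the
    function [F - A] is nondecreasing on [(a, b]], and it equals [F b] at [b].

    The coefficients [c_i] are singular at [a], and the behaviour of [A] there is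
    not obtained by a passage to the limit.  Instead, for [t] close to [a],
    [A t] is the integral over [[a, t]] of [L] along the single extremal that has
    the [(k-1)]-jet of [h] at [t]; on a short interval the Legendre condition
    makes extremals minimising, whence [A t <= F t - F a]
    ([field_action_near_le]).  Minimality is proved pointwise: with [u] the
    difference of the two curves, [L] along [u] plus the derivative of
    [N (s - a) \sum_(j < k) |u^(j)|^2] is nonnegative for a suitable constant [N]
    ([lagrangian_local_positivity]), and the added term integrates to zero.

    Hence [F a <= F t - A t <= F b] for [t] close to [a], which is [0 <= Q].  If
    [Q = 0], then [F - A] is constant on [(a, b]], so [v = 0], so the coefficients
    have zero derivative ([field_coef_deriv0]); they vanish at [b], hence
    everywhere, and [h = 0]. *)

(** * Differentiation within a segment *)

Section SegmentCalculus.
Context {R : realType}.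
Variables (a b : R).
Hypothesis hab : a < b.

Definition has_deriv_seg (V : normedModType R) (f : R -> V) (t : R) (l : V) :=
  diff_quotient f t @ within `[a, b] t^' --> l.

Lemma within_seg_dnbhs_proper (x y t : R) : x < y -> x <= t <= y ->
  ProperFilter (within `[x, y] t^').
Proof.
move=> xy /andP[xt ty]; apply: Build_ProperFilter_ex => P.
rewrite /within /dnbhs /= /within /= => -[/= d d0 dP].
have [tb|bt] := ltP t y.
  pose s := Num.min (t + d / 2) y.
  have ts : t < s by rewrite lt_min tb ltrDl divr_gt0.
  have sd : s <= t + d / 2 by rewrite ge_min lexx.
  have sy : s <= y by rewrite ge_min lexx orbT.
  have H1 : ball_ Num.norm t d s by rewrite /= ltr_distlC; apply/andP; split; lra.
  by exists s; apply: dP H1 _ _; rewrite ?gt_eqF//= in_itv /= sy (le_trans xt (ltW ts)).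
pose s := Num.max (t - d / 2) x.
have st : s < t by rewrite gt_max; apply/andP; split; lra.
have sd : t - d / 2 <= s by rewrite le_max lexx.
have sy : x <= s by rewrite le_max lexx orbT.
have H1 : ball_ Num.norm t d s by rewrite /= ltr_distlC; apply/andP; split; lra.
by exists s; apply: dP H1 _ _; rewrite ?lt_eqF//= in_itv /= sy (le_trans (ltW st) ty).
Qed.

Section General.
Variable V : normedModType R.
Implicit Types (f g : R -> V) (t : R).

Lemma has_deriv_seg_deriv f t l : a <= t <= b ->
  has_deriv_seg f t l -> deriv_seg a b f t = l.
Proof.
move=> tab fl; have F := within_seg_dnbhs_proper hab tab.
by apply: cvg_lim => //; exact: norm_hausdorff.
Qed.

Lemma derivable_seg_deriv f t :
  derivable_seg a b f t -> has_deriv_seg f t (deriv_seg a b f t).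
Proof. by []. Qed.

Lemma has_deriv_seg_derivable f t l : has_deriv_seg f t l ->
  derivable_seg a b f t.
Proof. by move=> fl; apply/cvg_ex; exists l. Qed.

Lemma has_deriv_seg_eq f g t l : a <= t <= b ->
  (forall s, a <= s <= b -> f s = g s) ->
  has_deriv_seg f t l -> has_deriv_seg g t l.
Proof.
move=> tab fg; apply: cvg_trans; apply: fmap_within_eq => s.
by rewrite inE /= in_itv /= => sab; rewrite /diff_quotient !fg.
Qed.

Lemma derivable_seg_eq f g t : a <= t <= b ->
  (forall s, a <= s <= b -> f s = g s) ->
  derivable_seg a b f t -> derivable_seg a b g t.
Proof.
move=> tab fg /derivable_seg_deriv df.
exact: has_deriv_seg_derivable (has_deriv_seg_eq tab fg df).
Qed.

Lemma deriv_seg_eq f g t : a <= t <= b ->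
  (forall s, a <= s <= b -> f s = g s) ->
  deriv_seg a b f t = deriv_seg a b g t.
Proof.
move=> tab fg; have E : {in `[a, b]%classic, diff_quotient f t =1 diff_quotient g t}.
  by move=> s; rewrite inE /= in_itv /= => sab; rewrite /diff_quotient !fg.
congr (lim _); apply/seteqP; split.
  by apply: (fmap_within_eq (F := t^')) => s /E.
exact: (fmap_within_eq (F := t^')) E.
Qed.

Lemma derivn_seg_eq m f g t : a <= t <= b ->
  (forall s, a <= s <= b -> f s = g s) ->
  derivn_seg a b m f t = derivn_seg a b m g t.
Proof.
move=> + fg; elim: m t => [|m IH] t tab /=; first exact: fg.
exact: deriv_seg_eq.
Qed.

Lemma has_deriv_segD f g t l l' : has_deriv_seg f t l ->
  has_deriv_seg g t l' -> has_deriv_seg (fun s => f s + g s) t (l + l').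
Proof.
move=> fl gl; rewrite /has_deriv_seg.
have -> : diff_quotient (fun s => f s + g s) t =
    (fun s => diff_quotient f t s + diff_quotient g t s).
  by apply/funext => s; rewrite /diff_quotient -scalerDr opprD addrACA.
exact: cvgD.
Qed.

Lemma has_deriv_segZ (c : R) f t l : has_deriv_seg f t l ->
  has_deriv_seg (fun s => c *: f s) t (c *: l).
Proof.
move=> fl; rewrite /has_deriv_seg.
have -> : diff_quotient (fun s => c *: f s) t =
    (fun s => c *: diff_quotient f t s).
  by apply/funext => s; rewrite /diff_quotient -scalerBr !scalerA mulrC.
by apply: cvgZ => //; exact: cvg_cst.
Qed.

Lemma has_deriv_segN f t l : has_deriv_seg f t l ->
  has_deriv_seg (fun s => - f s) t (- l).
Proof.
move=> /(has_deriv_segZ (c := -1)); rewrite scaleN1r.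
by under eq_fun do rewrite scaleN1r.
Qed.

Lemma has_deriv_segB f g t l l' : has_deriv_seg f t l ->
  has_deriv_seg g t l' -> has_deriv_seg (fun s => f s - g s) t (l - l').
Proof. by move=> fl /has_deriv_segN; exact: has_deriv_segD. Qed.

Lemma has_deriv_seg_cst (v : V) t : has_deriv_seg (fun=> v) t 0.
Proof.
rewrite /has_deriv_seg.
have -> : diff_quotient (fun=> v) t = (fun=> 0 : V).
  by apply/funext => s; rewrite /diff_quotient subrr scaler0.
exact: cvg_cst.
Qed.

Lemma has_deriv_seg_sum (I : Type) (r : seq I) (P : pred I) (F : I -> R -> V)
    (l : I -> V) t : (forall i, P i -> has_deriv_seg (F i) t (l i)) ->
  has_deriv_seg (fun s => \sum_(i <- r | P i) F i s) t
    (\sum_(i <- r | P i) l i).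
Proof.
move=> Fl; elim: r => [|i r IH].
  rewrite big_nil; under eq_fun do rewrite big_nil.
  exact: has_deriv_seg_cst.
rewrite big_cons; under eq_fun do rewrite big_cons.
case: ifP => // Pi; apply: has_deriv_segD => //; exact: Fl.
Qed.

Lemma cvg_subr_seg t : (s - t) @[s --> within `[a, b] t^'] --> (0 : R).
Proof.
apply: cvg_within_filter.
have : (s - t) @[s --> t] --> t - t by apply: cvgB; [exact: cvg_id|exact: cvg_cst].
by rewrite subrr; apply: cvg_trans; apply: cvg_app; exact: nbhs_dnbhs.
Qed.

Lemma has_deriv_seg_cvg f t l : has_deriv_seg f t l ->
  f s @[s --> within `[a, b] t^'] --> f t.
Proof.
move=> fl.
have E s : f t + (s - t) *: diff_quotient f t s = f s.
  rewrite /diff_quotient scalerA.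
  have [->|st] := eqVneq s t; first by rewrite subrr mul0r scale0r addr0.
  by rewrite mulfV ?subr_eq0// scale1r addrC subrK.
have : f t + (s - t) *: diff_quotient f t s @[s --> within `[a, b] t^'] -->
    f t + 0 *: l.
  apply: cvgD; first exact: cvg_cst.
  by apply: cvgZ => //; exact: cvg_subr_seg.
by rewrite scale0r addr0; under eq_fun do rewrite E.
Qed.

Lemma has_deriv_seg_continuous f t l : has_deriv_seg f t l ->
  f s @[s --> within `[a, b] (nbhs t)] --> f t.
Proof.
move=> /has_deriv_seg_cvg/cvgrPdist_le fl; apply/cvgrPdist_le => e e0.
have := fl e e0; rewrite /within /dnbhs /within /=.
apply: (@filterS _ (nbhs t)) => s /=; have [->|st h sab] := eqVneq s t; last exact: h.
by rewrite subrr normr0 ltW.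
Qed.

(** Restricting the filter to a smaller segment keeps the limit, so a function
    constant on that segment has derivative zero there. *)
Lemma has_deriv_seg_const f t l x y v : a <= x -> x < y -> y <= b ->
  x <= t <= y -> (forall s, x <= s <= y -> f s = v) ->
  has_deriv_seg f t l -> l = 0.
Proof.
move=> ax xy yb txy fv fl.
have F := within_seg_dnbhs_proper xy txy.
have fl' : diff_quotient f t @ within `[x, y] t^' --> l.
  apply: cvg_trans fl; apply: cvg_app.
  suff S : `[x, y] `<=` `[a, b] by move=> P; exact: (within_subset (F := t^')).
  by move=> s /=; rewrite !in_itv /= => /andP[xs sy]; apply/andP; split;
    [exact: le_trans xs|exact: le_trans yb].
have f0 : diff_quotient f t @ within `[x, y] t^' --> (0 : V).
  have E : {in `[x, y]%classic, diff_quotient f t =1 (fun=> 0 : V)}.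
    move=> s; rewrite inE /= in_itv /= => sxy.
    by rewrite /diff_quotient !fv// subrr scaler0.
  apply: (cvg_trans (fmap_within_eq _ E)); exact: cvg_cst.
exact: (cvg_unique (@norm_hausdorff _ _) fl' f0).
Qed.

End General.

Lemma has_deriv_seg_scale (V : normedModType R) (f : R -> R) (g : R -> V)
    t l l' : has_deriv_seg f t l -> has_deriv_seg g t l' ->
  has_deriv_seg (fun s => f s *: g s) t (l *: g t + f t *: l').
Proof.
move=> fl gl; rewrite /has_deriv_seg.
have -> : diff_quotient (fun s => f s *: g s) t =
    (fun s => diff_quotient f t s *: g s + f t *: diff_quotient g t s).
  apply/funext => s; rewrite /diff_quotient; set d := (s - t)^-1.
  have -> : d *: (f s - f t) = d * (f s - f t) by [].
  have -> : f t *: (d *: (g s - g t)) = d *: (f t *: (g s - g t)).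
    by rewrite !scalerA mulrC.
  rewrite -scalerA -scalerDr; congr (_ *: _).
  by rewrite [(_ - _) *: _]scalerBl [f t *: (_ - _)]scalerBr addrA subrK.
apply: cvgD; last by apply: cvgZ => //; exact: cvg_cst.
by apply: cvgZ => //; exact: has_deriv_seg_cvg gl.
Qed.

Lemma has_deriv_segM (f g : R -> R) t l l' : has_deriv_seg f t l ->
  has_deriv_seg g t l' ->
  has_deriv_seg (fun s => f s * g s) t (l * g t + f t * l').
Proof. exact: (@has_deriv_seg_scale R^o). Qed.

Lemma has_deriv_seg_id t : has_deriv_seg (fun s : R => s) t 1.
Proof.
have E : \forall s \near within `[a, b] t^',
    (fun=> 1) s = diff_quotient (fun s : R => s) t s.
  apply: (@filterS _ t^' _ _ _ _ (nbhs_dnbhs_neq t)) => s st _.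
  by rewrite /diff_quotient /GRing.scale /= mulVf// subr_eq0.
by apply: (cvg_trans (near_eq_cvg E)); exact: cvg_cst.
Qed.

Lemma has_deriv_seg_mxP m n (f : R -> 'M[R]_(m, n)) t l :
  has_deriv_seg f t l <->
  forall i j, has_deriv_seg (fun s => f s i j) t (l i j).
Proof.
have E i j s : diff_quotient (fun s => f s i j) t s = diff_quotient f t s i j.
  by rewrite /diff_quotient !mxE.
split=> [fl i j|fl].
  apply/cvgrPdist_le => e e0; have /cvgrPdist_le/(_ e e0) := fl.
  apply: filterS => s; apply: le_trans.
  rewrite [leRHS]/Num.Def.normr/= mx_normrE E.
  apply: le_trans; last exact: (le_bigmax _ _ (i, j)).
  by rewrite !mxE.
apply/cvgrPdist_le => e e0.
have : \forall s \near within `[a, b] t^', forall ij : 'I_m * 'I_n,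
    `|l ij.1 ij.2 - diff_quotient (fun s => f s ij.1 ij.2) t s| <= e.
  apply: filter_forall => ij.
  by have /cvgrPdist_le/(_ e e0) := fl ij.1 ij.2.
apply: filterS => s H.
rewrite /Num.Def.normr/= mx_normrE (bigmax_le _ (ltW e0))//= => ij _.
by rewrite !mxE; have := H ij; rewrite E !mxE.
Qed.

Lemma has_deriv_seg_mulmx m n p (A : R -> 'M[R]_(m, n)) (B : R -> 'M[R]_(n, p))
    t dA dB : has_deriv_seg A t dA -> has_deriv_seg B t dB ->
  has_deriv_seg (fun s => A s *m B s) t (dA *m B t + A t *m dB).
Proof.
move=> /has_deriv_seg_mxP hA /has_deriv_seg_mxP hB.
apply/has_deriv_seg_mxP => i j; rewrite !mxE -big_split /=.
under eq_fun do rewrite mxE.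
by apply: has_deriv_seg_sum => k _; apply: has_deriv_segM.
Qed.

Lemma has_deriv_seg_trmx m n (A : R -> 'M[R]_(m, n)) t dA :
  has_deriv_seg A t dA -> has_deriv_seg (fun s => (A s)^T) t dA^T.
Proof.
move=> /has_deriv_seg_mxP hA; apply/has_deriv_seg_mxP => i j; rewrite mxE.
by under eq_fun do rewrite mxE; exact: hA.
Qed.

End SegmentCalculus.

(** * Monotone functions and primitives on a segment *)

Section Monotonicity.
Context {R : realType}.
Variables (a b : R).
Hypothesis hab : a < b.
Local Notation has_deriv_seg := (has_deriv_seg a b).

Lemma has_deriv_seg_is_derive (f : R -> R) (t l : R) : a < t < b ->
  has_deriv_seg f t l -> is_derive t 1 f l.
Proof.
move=> /andP[at_ tb] fl.
suff H : h^-1 *: ((f \o shift t) (h *: 1) - f t) @[h --> 0^'] --> l.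
  apply: DeriveDef; first by apply/cvg_ex; exists l.
  by apply: cvg_lim => //; exact: norm_hausdorff.
apply/cvgrPdist_le => e e0; have /cvgrPdist_le/(_ e e0) := fl.
rewrite /within /dnbhs /within /= => -[/= d d0 dP].
exists (Num.min d (Num.min (t - a) (b - t))) => /=.
  by rewrite !lt_min d0 !subr_gt0 at_ tb.
move=> h /=; rewrite sub0r normrN !lt_min => /and3P[hd ha hb] h0.
have := dP (h + t); rewrite /diff_quotient addrK /GRing.scale /= mulr1.
apply.
- by rewrite opprD addrCA subrr addr0 normrN.
- by rewrite -subr_eq0 addrK.
- rewrite in_itv /=; move: ha hb; rewrite !ltr_norml.
  by move=> /andP[? ?] /andP[? ?]; apply/andP; split; lra.
Qed.

Lemma is_derive_has_deriv_seg (f : R -> R) (t l : R) :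
  is_derive t 1 f l -> has_deriv_seg f t l.
Proof.
move=> [/cvg_ex[/= l' fl'] fl]; have E : l' = l.
  by rewrite -fl; apply/esym/cvg_lim => //; exact: norm_hausdorff.
subst l'; apply/cvgrPdist_le => e e0; have /cvgrPdist_le/(_ e e0) := fl'.
rewrite /within /dnbhs /within /= => -[/= d d0 dP].
exists d => //= s sd st _.
have := dP (s - t); rewrite /diff_quotient /GRing.scale /= mulr1 subrK; apply.
  by rewrite sub0r opprB.
by rewrite subr_eq0.
Qed.

Lemma has_deriv_seg_le (f g : R -> R) x y : a <= x -> x <= y -> y <= b ->
  (forall t, x <= t <= y -> has_deriv_seg f t (g t)) ->
  (forall t, x <= t <= y -> 0 <= g t) -> f x <= f y.
Proof.
move=> ax xy yb fg g0.
have D t : t \in `]x, y[ -> is_derive t 1 f (g t).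
  rewrite in_itv /= => /andP[xt ty]; apply: has_deriv_seg_is_derive.
    by rewrite (le_lt_trans ax xt) (lt_le_trans ty yb).
  by apply: fg; rewrite !ltW.
apply: (@ger0_derive1_ndecr R f x y) => //.
- by move=> t /D [].
- move=> t txy; have [_ Dt] := D t txy; rewrite derive1E Dt.
  by apply: g0; move: txy; rewrite in_itv /= => /andP[/ltW-> /ltW->].
- apply/subspace_continuousP => t /=; rewrite in_itv /= => txy.
  apply: cvg_trans (has_deriv_seg_continuous (fg t txy)); apply: cvg_app.
  suff S : `[x, y] `<=` `[a, b] by move=> P; exact: (within_subset (F := nbhs t)).
  by move=> s /=; rewrite !in_itv /= => /andP[xs sy]; apply/andP; split;
    [exact: le_trans xs|exact: le_trans yb].
Qed.

Lemma has_deriv_seg0_eq (f : R -> R) x y : a <= x -> x <= y -> y <= b ->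
  (forall t, x <= t <= y -> has_deriv_seg f t 0) -> f x = f y.
Proof.
move=> ax xy yb f0; apply/eqP; rewrite eq_le -[f y <= f x]lerN2; apply/andP.
split; first exact: (@has_deriv_seg_le f (fun=> 0)).
apply: (@has_deriv_seg_le (fun s => - f s) (fun=> 0)) => // t /f0.
by move=> /has_deriv_segN; rewrite oppr0.
Qed.

(** Extending [f] by its boundary values makes it continuous on the whole
    line, so that the two-sided fundamental theorem of calculus also yields the
    one-sided derivatives of the primitive at the end points. *)
Lemma continuous_seg_primitive (f : R -> R) :
  (forall t, a <= t <= b -> f s @[s --> within `[a, b] (nbhs t)] --> f t) ->
  exists2 F : R -> R, (forall t, a <= t <= b -> has_deriv_seg F t (f t)) &
    \int[lebesgue_measure]_(t in `[a, b]) f t = F b - F a.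
Proof.
move=> cf.
pose clamp (s : R) := Num.max a (Num.min s b).
have clampE s : a <= s <= b -> clamp s = s.
  by move=> /andP[as_ sb]; rewrite /clamp min_l// max_r.
have clamp_itv s : a <= clamp s <= b.
  by rewrite /clamp le_max lexx /= ge_max (ltW hab) ge_min lexx orbT.
have clampC : continuous clamp.
  move=> t; apply: (@continuous_max R R (fun=> a) (fun s => Num.min s b)).
    exact: cvg_cst.
  apply: (@continuous_min R R (fun s => s) (fun=> b)); first exact: cvg_id.
  exact: cvg_cst.
pose g s := f (clamp s).
have gC : continuous g.
  move=> t; apply: (cvg_comp _ _ _ (cf (clamp t) (clamp_itv t))).
  move=> P /= Pt; have := clampC t _ Pt; apply: (@filterS _ (nbhs t)) => s /=.
  by apply; rewrite in_itv /=.
have gI : lebesgue_measure.-integrable `[a - 1, b + 1] (EFin \o g).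
  apply: continuous_compact_integrable; first exact: segment_compact.
  exact: continuous_subspaceT.
pose F x := \int[lebesgue_measure]_(t in `[a - 1, x]) g t.
have FD t : a <= t <= b -> is_derive t 1 F (g t).
  move=> /andP[at_ tb].
  have H1 : t < b + 1 by lra.
  have H2 : a - 1 < t by lra.
  have [FD1 FD2] := continuous_FTC1_closed H1 gI H2 (gC t).
  by apply: DeriveDef => //; rewrite -derive1E.
exists F => [t tab|].
  by have := FD t tab; rewrite /g clampE//; exact: is_derive_has_deriv_seg.
have -> : \int[lebesgue_measure]_(t in `[a, b]) f t =
    \int[lebesgue_measure]_(t in `[a, b]) g t.
  by apply: eq_Rintegral => t; rewrite inE /= in_itv /= => tab;
    rewrite /g clampE.
rewrite /Rintegral (continuous_FTC2 (F := F))//.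
- exact: continuous_subspaceT.
- have FC t : a <= t <= b -> {for t, continuous F}.
    move=> /FD[D _]; apply: differentiable_continuous.
    exact/derivable1_diffP.
  split.
  + move=> t; rewrite in_itv /= => /andP[/ltW ta /ltW tb].
    by have [] := FD t; first by rewrite ta tb.
  + by apply: cvg_at_right_filter; apply: FC; rewrite lexx ltW.
  + by apply: cvg_at_left_filter; apply: FC; rewrite lexx ltW.
- move=> t; rewrite in_itv /= => /andP[/ltW ta /ltW tb].
  by rewrite derive1E; have [] := FD t; first by rewrite ta tb.
Qed.

End Monotonicity.

(** * Higher derivatives, determinants and inverses *)

Section HigherDerivatives.
Context {R : realType}.
Variables (a b : R).
Hypothesis hab : a < b.
Local Notation has_deriv_seg := (has_deriv_seg a b).

Section Vector.
Variable V : normedModType R.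
Implicit Types f g : R -> V.

Lemma derivablen_segS m f : derivablen_seg a b m.+1 f <->
  (forall t, a <= t <= b -> derivable_seg a b f t) /\
  derivablen_seg a b m (deriv_seg a b f).
Proof.
split=> [df|[df dfm] [|j] t jm tab].
- split=> [t tab|j t jm tab]; first exact: (df 0).
  by rewrite /derivn_seg -iterSr; exact: (df j.+1).
- exact: df.
- by rewrite /derivn_seg iterSr; exact: dfm.
Qed.

Lemma derivablen_seg_le m m' f : (m' <= m)%N ->
  derivablen_seg a b m f -> derivablen_seg a b m' f.
Proof. by move=> le df j t jm; apply: df; exact: leq_trans le. Qed.

Lemma derivablen_seg_eq m f g : (forall s, a <= s <= b -> f s = g s) ->
  derivablen_seg a b m f -> derivablen_seg a b m g.
Proof.
move=> fg df j t jm tab; apply: (derivable_seg_eq tab _ (df j t jm tab)).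
by move=> s sab; exact: derivn_seg_eq.
Qed.

Lemma derivablen_seg_derivn m j f : derivablen_seg a b (m + j) f ->
  derivablen_seg a b m (derivn_seg a b j f).
Proof.
move=> df i t im tab; rewrite /derivn_seg -iterD; apply: df => //.
by rewrite ltn_add2r.
Qed.

Lemma derivablen_seg_has_deriv m j f t : derivablen_seg a b m f -> (j < m)%N ->
  a <= t <= b ->
  has_deriv_seg (derivn_seg a b j f) t (derivn_seg a b j.+1 f t).
Proof. by move=> df jm tab; exact: (df j t jm tab). Qed.

Lemma derivablen_segD m f g : derivablen_seg a b m f ->
  derivablen_seg a b m g -> derivablen_seg a b m (fun s => f s + g s).
Proof.
elim: m f g => [//|m IH] f g /derivablen_segS[df df'] /derivablen_segS[dg dg'].
apply/derivablen_segS; split=> [t tab|].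
  exact: has_deriv_seg_derivable (has_deriv_segD (df t tab) (dg t tab)).
apply: derivablen_seg_eq (IH _ _ df' dg') => s sab; apply/esym.
by apply: has_deriv_seg_deriv => //; apply: has_deriv_segD; [exact: df|exact: dg].
Qed.

Lemma derivablen_seg0 m : derivablen_seg a b m (fun=> 0 : V).
Proof.
elim: m => [//|m IH]; apply/derivablen_segS; split=> [t tab|].
  exact: has_deriv_seg_derivable (@has_deriv_seg_cst _ _ _ _ 0 t).
apply: derivablen_seg_eq IH => s sab; apply/esym.
by apply: has_deriv_seg_deriv => //; exact: has_deriv_seg_cst.
Qed.

Lemma derivablen_seg_sum m (I : Type) (r : seq I) (F : I -> R -> V) :
  (forall i, derivablen_seg a b m (F i)) ->
  derivablen_seg a b m (fun s => \sum_(i <- r) F i s).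
Proof.
move=> dF; elim: r => [|i r IH].
  by under eq_fun do rewrite big_nil; exact: derivablen_seg0.
by under eq_fun do rewrite big_cons; exact: derivablen_segD.
Qed.

End Vector.

Lemma derivablen_seg_mulmx m p q r (A : R -> 'M[R]_(p, q))
    (B : R -> 'M[R]_(q, r)) :
  derivablen_seg a b m A -> derivablen_seg a b m B ->
  derivablen_seg a b m (fun s => A s *m B s).
Proof.
elim: m A B => [//|m IH] A B /[dup] /(derivablen_seg_le (leqnSn m)) Am
  /derivablen_segS[dA dA'] /[dup] /(derivablen_seg_le (leqnSn m)) Bm
  /derivablen_segS[dB dB'].
apply/derivablen_segS; split=> [t tab|].
  exact: has_deriv_seg_derivable (has_deriv_seg_mulmx (dA t tab) (dB t tab)).
apply: derivablen_seg_eq (derivablen_segD (IH _ _ dA' Bm) (IH _ _ Am dB')).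
move=> s sab; apply/esym; apply: has_deriv_seg_deriv => //.
by apply: has_deriv_seg_mulmx; [exact: dA|exact: dB].
Qed.

Lemma derivablen_seg_trmx m p q (A : R -> 'M[R]_(p, q)) :
  derivablen_seg a b m A -> derivablen_seg a b m (fun s => (A s)^T).
Proof.
elim: m A => [//|m IH] A /derivablen_segS[dA dA'].
apply/derivablen_segS; split=> [t tab|].
  exact: has_deriv_seg_derivable (has_deriv_seg_trmx (dA t tab)).
apply: derivablen_seg_eq (IH _ dA') => s sab; apply/esym.
by apply: has_deriv_seg_deriv => //; apply: has_deriv_seg_trmx; exact: dA.
Qed.

Lemma derivable_seg_prod (I : Type) (r : seq I) (F : I -> R -> R) t :
  (forall i, derivable_seg a b (F i) t) ->
  derivable_seg a b (fun s => \prod_(i <- r) F i s) t.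
Proof.
move=> dF; elim: r => [|i r IH].
  under eq_fun do rewrite big_nil.
  exact: has_deriv_seg_derivable (@has_deriv_seg_cst _ _ _ R^o 1 t).
under eq_fun do rewrite big_cons.
exact: has_deriv_seg_derivable (has_deriv_segM (dF i) IH).
Qed.

Lemma derivable_seg_det n (A : R -> 'M[R]_n) t :
  (forall i j, derivable_seg a b (fun s => A s i j) t) ->
  derivable_seg a b (fun s => \det (A s)) t.
Proof.
move=> dA; apply: has_deriv_seg_derivable.
apply: (@has_deriv_seg_sum _ _ _ R^o) => s _.
apply: has_deriv_segM; first exact: (@has_deriv_seg_cst _ _ _ R^o).
by apply: derivable_seg_deriv; apply: derivable_seg_prod => i; exact: dA.
Qed.

Lemma derivable_seg_adj n (A : R -> 'M[R]_n) t :
  (forall i j, derivable_seg a b (fun s => A s i j) t) ->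
  forall i j, derivable_seg a b (fun s => (\adj (A s)) i j) t.
Proof.
move=> dA i j; under eq_fun do rewrite mxE /cofactor.
apply: has_deriv_seg_derivable.
apply: has_deriv_segM; first exact: (@has_deriv_seg_cst _ _ _ R^o).
apply: derivable_seg_deriv; apply: derivable_seg_det => i' j'.
by under eq_fun do rewrite !mxE; exact: dA.
Qed.

Lemma has_deriv_segV (f : R -> R) t l : f t != 0 -> has_deriv_seg f t l ->
  has_deriv_seg (fun s => (f s)^-1) t (- ((f t)^-1 * (f t)^-1 * l)).
Proof.
move=> ft0 fl.
have H : - ((f s)^-1 * (f t)^-1 * diff_quotient f t s)
    @[s --> within `[a, b] t^'] --> - ((f t)^-1 * (f t)^-1 * l).
  apply: cvgN; apply: cvgM => //; apply: cvgM; last exact: cvg_cst.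
  by apply: cvgV => //; exact: has_deriv_seg_cvg fl.
have E : \forall s \near within `[a, b] t^',
    - ((f s)^-1 * (f t)^-1 * diff_quotient f t s) =
    diff_quotient (fun s => (f s)^-1) t s.
  have ftn : 0 < `|f t| by rewrite normr_gt0.
  have /cvgrPdist_lt/(_ _ ftn) := has_deriv_seg_cvg fl.
  apply: filterS => s fs; have fs0 : f s != 0.
    by apply/eqP => fs0; move: fs; rewrite fs0 subr0 ltxx.
  rewrite /diff_quotient /GRing.scale /=.
  have -> : (f s)^-1 - (f t)^-1 = - ((f s)^-1 * (f t)^-1 * (f s - f t)).
    by field; rewrite fs0 ft0.
  ring.
exact: (cvg_trans (near_eq_cvg E)).
Qed.

End HigherDerivatives.

(** * Algebra of the Lagrangian *)

Section DotProduct.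
Context {R : realType} {n : nat}.
Implicit Types (u v w : 'cV[R]_n) (A : 'M[R]_n).

Definition dotv u v : R := (u^T *m v) 0 0.

Lemma dotvE u v : dotv u v = \sum_i u i 0 * v i 0.
Proof. by rewrite /dotv mxE; apply: eq_bigr => i _; rewrite mxE. Qed.

Lemma dotvC u v : dotv u v = dotv v u.
Proof. by rewrite !dotvE; apply: eq_bigr => i _; rewrite mulrC. Qed.

Lemma dotvDr u v w : dotv u (v + w) = dotv u v + dotv u w.
Proof. by rewrite /dotv mulmxDr mxE. Qed.

Lemma dotvDl u v w : dotv (u + v) w = dotv u w + dotv v w.
Proof. by rewrite !(dotvC _ w) dotvDr. Qed.

Lemma dotvZr (e : R) u v : dotv u (e *: v) = e * dotv u v.
Proof. by rewrite /dotv -scalemxAr mxE. Qed.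

Lemma dotvZl (e : R) u v : dotv (e *: u) v = e * dotv u v.
Proof. by rewrite !(dotvC _ v) dotvZr. Qed.

Lemma dotv0r u : dotv u 0 = 0.
Proof. by rewrite /dotv mulmx0 mxE. Qed.

Lemma dotv0l u : dotv 0 u = 0.
Proof. by rewrite dotvC dotv0r. Qed.

Lemma dotvNr u v : dotv u (- v) = - dotv u v.
Proof. by rewrite -scaleN1r dotvZr mulN1r. Qed.

Lemma dotvBr u v w : dotv u (v - w) = dotv u v - dotv u w.
Proof. by rewrite dotvDr dotvNr. Qed.

Lemma dotvBl u v w : dotv (u - v) w = dotv u w - dotv v w.
Proof. by rewrite !(dotvC _ w) dotvBr. Qed.

Lemma dotv_sumr (I : Type) (r : seq I) (P : pred I) (F : I -> 'cV[R]_n) u :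
  dotv u (\sum_(i <- r | P i) F i) = \sum_(i <- r | P i) dotv u (F i).
Proof. by rewrite /dotv mulmx_sumr summxE. Qed.

Lemma dotv_suml (I : Type) (r : seq I) (P : pred I) (F : I -> 'cV[R]_n) u :
  dotv (\sum_(i <- r | P i) F i) u = \sum_(i <- r | P i) dotv (F i) u.
Proof. by rewrite dotvC dotv_sumr; apply: eq_bigr => i _; rewrite dotvC. Qed.

Lemma dotv_mulmx A u v : dotv u (A *m v) = dotv (A^T *m u) v.
Proof. by rewrite /dotv trmx_mul trmxK mulmxA. Qed.

Lemma dotv_mulmxE A u v : (u^T *m A *m v) 0 0 = dotv u (A *m v).
Proof. by rewrite /dotv mulmxA. Qed.

Lemma dotvv_ge0 u : 0 <= dotv u u.
Proof. by rewrite dotvE; apply: sumr_ge0 => i _; rewrite -expr2 sqr_ge0. Qed.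

Lemma dotv_delta u i : dotv u (delta_mx i 0) = u i 0.
Proof.
rewrite dotvE (bigD1 i)//= big1 ?addr0 ?mxE ?eqxx ?mulr1// => j ji.
by rewrite mxE (negbTE ji) mulr0.
Qed.

End DotProduct.

Section LagrangianAlgebra.
Context {R : realType} {k n : nat}.
Variables (Mdiag : 'I_k.+1 -> R -> 'M[R]_n) (Moff : 'I_k -> R -> 'M[R]_n).
Variable t : R.
Implicit Types q r : 'I_k.+1 -> 'cV[R]_n.

Local Notation lo i := (widen_ord (leqnSn k) i).
Local Notation hi i := (lift ord0 i).
Local Notation L := (lagrangian Mdiag Moff t).

(** The gradient of [L t] in its [j]-th argument: [M_jj q_j + M_j(j+1) q_(j+1) +
    M_(j-1)j^T q_(j-1)].  Summing over all off-diagonal blocks with a selector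
    avoids special cases at [j = 0] and [j = k]. *)
Definition lag_grad q (j : 'I_k.+1) : 'cV[R]_n :=
  Mdiag j t *m q j +
  \sum_(i < k) ((Moff i t *m q (hi i)) *+ (lo i == j)
                + ((Moff i t)^T *m q (lo i)) *+ (hi i == j)).

Definition lag_polar q r : R := \sum_j dotv (lag_grad q j) (r j).

Lemma lagrangianE q : L q =
  2^-1 * (\sum_i dotv (q i) (Mdiag i t *m q i))
  + \sum_(i < k) dotv (q (lo i)) (Moff i t *m q (hi i)).
Proof.
by rewrite /lagrangian; congr (_ * _ + _); apply: eq_bigr => i _;
  rewrite dotv_mulmxE.
Qed.

Lemma lag_polarE q r : lag_polar q r =
  \sum_j dotv (Mdiag j t *m q j) (r j)
  + \sum_(i < k) (dotv (Moff i t *m q (hi i)) (r (lo i))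
                  + dotv ((Moff i t)^T *m q (lo i)) (r (hi i))).
Proof.
have H (u : 'cV[R]_n) j i : dotv (u *+ (j == i)) (r i) =
    if i == j then dotv u (r i) else 0.
  by rewrite eq_sym; case: eqP => // _; rewrite mulr0n dotv0l.
rewrite /lag_polar; under eq_bigr do rewrite /lag_grad dotvDl dotv_suml.
rewrite big_split /= exchange_big /=; congr (_ + _); apply: eq_bigr => i _.
under eq_bigr do rewrite dotvDl !H.
by rewrite big_split /= -!big_mkcond /= !big_pred1_eq.
Qed.

Hypothesis Msym : forall i, (Mdiag i t)^T = Mdiag i t.

(** Symmetry of the diagonal blocks merges the two halves of the cross term.  The
    other algebraic properties of [L] and
    of its polar form follow by choosing [e] and [r]. *)
Lemma lagrangian_expand (e : R) q r : L (fun i => q i + e *: r i) =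
  L q + e * lag_polar q r + e ^+ 2 * L r.
Proof.
rewrite !lagrangianE lag_polarE.
have -> : \sum_i dotv (q i + e *: r i) (Mdiag i t *m (q i + e *: r i)) =
    \sum_i dotv (q i) (Mdiag i t *m q i)
    + 2 * e * \sum_i dotv (Mdiag i t *m q i) (r i)
    + e ^+ 2 * \sum_i dotv (r i) (Mdiag i t *m r i).
  rewrite !mulr_sumr -!big_split /=; apply: eq_bigr => i _.
  rewrite mulmxDr -scalemxAr !(dotvDl, dotvDr) !(dotvZl, dotvZr).
  rewrite (dotv_mulmx _ (q i) (r i)) Msym (dotvC (r i) (_ *m q i)); ring.
have -> : \sum_(i < k) dotv (q (lo i) + e *: r (lo i))
      (Moff i t *m (q (hi i) + e *: r (hi i))) =
    \sum_(i < k) dotv (q (lo i)) (Moff i t *m q (hi i))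
    + e * \sum_(i < k) (dotv (Moff i t *m q (hi i)) (r (lo i))
                        + dotv ((Moff i t)^T *m q (lo i)) (r (hi i)))
    + e ^+ 2 * \sum_(i < k) dotv (r (lo i)) (Moff i t *m r (hi i)).
  rewrite !mulr_sumr -!big_split /=; apply: eq_bigr => i _.
  rewrite mulmxDr -scalemxAr !(dotvDl, dotvDr) !(dotvZl, dotvZr).
  rewrite (dotv_mulmx _ (q (lo i)) (r (hi i))) (dotvC (r (lo i))); ring.
by field.
Qed.

Lemma lagrangian0 : L (fun=> 0) = 0.
Proof.
by rewrite lagrangianE !big1 ?mulr0 ?addr0// => i _; rewrite dotv0l.
Qed.

Lemma lag_polar_diag q : lag_polar q q = 2 * L q.
Proof.
have := lagrangian_expand (-1) q q.
have -> : (fun i => q i + -1 *: q i) = (fun=> 0).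
  by apply/funext => i; rewrite scaleN1r subrr.
rewrite lagrangian0 sqrrN expr1n; lra.
Qed.

Lemma lag_polarC q r : lag_polar q r = lag_polar r q.
Proof.
have := lagrangian_expand 1 q r; have := lagrangian_expand 1 r q.
have -> : (fun i => r i + 1 *: q i) = (fun i => q i + 1 *: r i).
  by apply/funext => i; rewrite !scale1r addrC.
rewrite expr1n; lra.
Qed.

Lemma lag_polar_sumr (I : Type) (s : seq I) (c : I -> R)
    (F : I -> 'I_k.+1 -> 'cV[R]_n) q :
  lag_polar q (fun j => \sum_(i <- s) c i *: F i j) =
  \sum_(i <- s) c i * lag_polar q (F i).
Proof.
under eq_bigr do rewrite mulr_sumr; rewrite exchange_big /=.
apply: eq_bigr => j _; rewrite dotv_sumr.
by apply: eq_bigr => i _; rewrite dotvZr.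
Qed.

Lemma lag_polar_suml (I : Type) (s : seq I) (c : I -> R)
    (F : I -> 'I_k.+1 -> 'cV[R]_n) q :
  lag_polar (fun j => \sum_(i <- s) c i *: F i j) q =
  \sum_(i <- s) c i * lag_polar (F i) q.
Proof.
by rewrite lag_polarC lag_polar_sumr; under eq_bigr do rewrite lag_polarC.
Qed.

Lemma lag_polar_top q r : (forall i : 'I_k, r (lo i) = 0) ->
  lag_polar q r = dotv (lag_grad q ord_max) (r ord_max).
Proof.
move=> r0; rewrite /lag_polar big_ord_recr /= big1 ?add0r// => i _.
by rewrite r0 dotv0r.
Qed.

Lemma lagrangian_top r : (forall i : 'I_k, r (lo i) = 0) ->
  L r = 2^-1 * dotv (r ord_max) (Mdiag ord_max t *m r ord_max).
Proof.
move=> r0; rewrite lagrangianE big_ord_recr /= !big1 ?add0r ?addr0// => i _;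
  by rewrite r0 dotv0l.
Qed.

Lemma grad_arg_lag_grad (j : 'I_k.+1) q : grad_arg L j q = lag_grad q j.
Proof.
apply/colP => l; rewrite mxE.
pose r i : 'cV[R]_n := if i == j then delta_mx l 0 else 0.
have -> : (fun e : R => L (fun i => if i == j then q i + e *: delta_mx l 0
                                    else q i)) =
    (fun e => L q + e * lag_polar q r + e ^+ 2 * L r).
  apply/funext => e; rewrite -lagrangian_expand; congr (lagrangian _ _ _ _).
  by apply/funext => i; rewrite /r; case: ifP => //; rewrite scaler0 addr0.
have -> : lag_grad q j l 0 = lag_polar q r.
  rewrite /lag_polar (bigD1 j)//= big1 ?addr0.
    by rewrite /r eqxx dotv_delta.
  by move=> i ij; rewrite /r (negbTE ij) dotv0r.
set x := lag_polar _ _; set y := L r; set z := L q.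
rewrite derive1E.
have D : is_derive (0 : R) 1 (fun e : R => z + e * x + e ^+ 2 * y) x.
  apply: is_derive_eq.
  rewrite !scaler0 /GRing.scale /=; ring.
by rewrite (derive_val (is_derive := D)).
Qed.

End LagrangianAlgebra.

(** * Momenta of a Jacobi solution *)

Section Momenta.
Context {R : realType} {k n : nat}.
Variables (a b : R) (Mdiag : 'I_k.+1 -> R -> 'M[R]_n)
  (Moff : 'I_k -> R -> 'M[R]_n).
Hypotheses (hab : a < b)
  (Mdiag_smooth : forall i, smooth_seg a b (Mdiag i))
  (Moff_smooth : forall i, smooth_seg a b (Moff i))
  (Mdiag_sym : forall i t, a <= t <= b -> (Mdiag i t)^T = Mdiag i t).
Local Notation has_deriv_seg := (has_deriv_seg a b).
Local Notation G := (lag_grad Mdiag Moff).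

(** Indexed so that [momentum h 0] is the left-hand side of the Jacobi equation,
    while [momentum h j.+1] is the Ostrogradsky momentum conjugate to [h^(j)]. *)
Definition momentum (h : R -> 'cV[R]_n) (j : nat) (t : R) : 'cV[R]_n :=
  \sum_(l < k.+1 | (j <= l)%N)
    (-1) ^+ (l - j) *:
      derivn_seg a b (l - j) (fun s => G s (jet a b h s) l) t.

Definition momentum_pairing (h u : R -> 'cV[R]_n) (t : R) : R :=
  \sum_(j < k) dotv (momentum h j.+1 t) (derivn_seg a b j u t).

(** For [l < k] the highest derivative in the gradient is [h^(l+1)], which leaves
    [2k - l - 1 >= l] further derivatives; for [l = k] it is [h^(k)], which leaves
    [k]. *)
Lemma derivablen_seg_lag_grad (h : R -> 'cV[R]_n) (l : 'I_k.+1) :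
  derivablen_seg a b (2 * k) h ->
  derivablen_seg a b l (fun s => G s (jet a b h s) l).
Proof.
move=> dh.
have jetD (i : 'I_k.+1) m : (m + i <= 2 * k)%N ->
    derivablen_seg a b m (fun s => jet a b h s i).
  by move=> mi; apply: derivablen_seg_derivn; exact: derivablen_seg_le dh.
have lk : (l <= k)%N by rewrite -ltnS.
rewrite /lag_grad; apply: derivablen_segD => //.
  apply: derivablen_seg_mulmx => //; first exact: Mdiag_smooth.
  by apply: jetD; rewrite mul2n -addnn leq_add.
apply: derivablen_seg_sum => // i; apply: derivablen_segD => //.
  have [/eqP|] := boolP (_ == l); last first.
    by move=> _; under eq_fun do rewrite mulr0n; exact: derivablen_seg0.
  move=> /(congr1 val)/= il; under eq_fun do rewrite mulr1n.
  apply: derivablen_seg_mulmx => //; first exact: Moff_smooth.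
  apply: jetD; rewrite /= /bump /= -il mul2n -addnn.
  by rewrite leq_add // ?add1n// ltnW.
have [/eqP|] := boolP (_ == l); last first.
  by move=> _; under eq_fun do rewrite mulr0n; exact: derivablen_seg0.
move=> /(congr1 val)/= il; under eq_fun do rewrite mulr1n.
apply: derivablen_seg_mulmx => //.
  by apply: derivablen_seg_trmx => //; exact: Moff_smooth.
by apply: jetD; rewrite mul2n -addnn leq_add//= ltnW.
Qed.

Lemma momentum_has_deriv (h : R -> 'cV[R]_n) (j : 'I_k.+1) t :
  derivablen_seg a b (2 * k) h -> a <= t <= b ->
  has_deriv_seg (momentum h j.+1) t (G t (jet a b h t) j - momentum h j t).
Proof.
move=> dh tab.
have -> : G t (jet a b h t) j - momentum h j t =
    \sum_(l < k.+1 | (j < l)%N) (-1) ^+ (l - j.+1) *: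
      derivn_seg a b (l - j.+1).+1 (fun s => G s (jet a b h s) l) t.
  rewrite /momentum (bigD1 j)//= subnn expr0 scale1r opprD addrA subrr add0r.
  rewrite -sumrN; apply: eq_big => [l|l].
    by rewrite ltn_neqAle andbC eq_sym.
  move=> /andP[jl lj]; have {}jl : (j < l)%N.
    by rewrite ltn_neqAle jl andbT eq_sym.
  by rewrite -{1 2}(subSS j l) subSn// exprS mulN1r scaleNr opprK.
apply: has_deriv_seg_sum => l jl; apply: has_deriv_segZ.
apply: (derivablen_seg_has_deriv (m := l)) => //.
  exact: derivablen_seg_lag_grad.
by rewrite ltn_subrL (leq_ltn_trans _ jl).
Qed.

Lemma momentum_top (h : R -> 'cV[R]_n) t :
  momentum h k t = G t (jet a b h t) ord_max.
Proof.
rewrite /momentum (big_pred1 ord_max) /= => [|l].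
  by rewrite subnn expr0 scale1r.
by rewrite /= -val_eqE /= eqn_leq -[(l <= k)%N]ltnS ltn_ord.
Qed.

Lemma momentum_jacobi0 (h : R -> 'cV[R]_n) t :
  jacobi_solution a b Mdiag Moff h -> a <= t <= b -> momentum h 0 t = 0.
Proof.
move=> [_ /(_ t) J] tab; rewrite -[RHS](J tab) /momentum.
apply: eq_bigr => l _; rewrite subn0; congr (_ *: _).
apply: derivn_seg_eq => // s sab; rewrite grad_arg_lag_grad// => i.
exact: Mdiag_sym.
Qed.

(** Differentiating each product and inserting the Hamilton equations makes the
    terms [p_j . u^(j)] telescope; the Jacobi equation kills the one with [j = 0],
    and the one with [j = k] is the missing top term of the polar form. *)
Lemma momentum_pairing_has_deriv (h u : R -> 'cV[R]_n) t :
  jacobi_solution a b Mdiag Moff h -> derivablen_seg a b k u -> a <= t <= b ->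
  has_deriv_seg (momentum_pairing h u) t
    (lag_polar Mdiag Moff t (jet a b h t) (jet a b u t)).
Proof.
move=> hJ du tab; have [dh _] := hJ.
pose p j := momentum h j t; pose U j := derivn_seg a b j u t.
have -> : lag_polar Mdiag Moff t (jet a b h t) (jet a b u t) =
    \sum_(j < k) (dotv (G t (jet a b h t) (widen_ord (leqnSn k) j) - p j) (U j)
                  + dotv (p j.+1) (U j.+1)).
  transitivity (\sum_(j < k.+1) dotv (p j) (U j)
      + \sum_(j < k) dotv (G t (jet a b h t) (widen_ord (leqnSn k) j) - p j) (U j)).
    rewrite /lag_polar !big_ord_recr /= {2}/p momentum_top addrAC -big_split /=.
    by congr (_ + _); apply: eq_bigr => j _; rewrite -dotvDl addrC subrK.
  rewrite big_ord_recl {1}/p momentum_jacobi0// dotv0l add0r.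
  by rewrite addrC -big_split.
apply: (@has_deriv_seg_sum _ _ _ R^o) => j _.
have D1 := momentum_has_deriv (j := widen_ord (leqnSn k) j) dh tab.
have D2 := derivablen_seg_has_deriv du (ltn_ord j) tab.
have /has_deriv_seg_mxP/(_ 0 0) :=
  has_deriv_seg_mulmx (has_deriv_seg_trmx D1) D2.
by rewrite mxE.
Qed.

End Momenta.

(** * Positivity on short initial intervals *)

Section Coercivity.
Context {R : realType} {n : nat}.
Implicit Types (u v w : 'cV[R]_n) (A : 'M[R]_n).

Lemma mx_entry_le_norm p q (A : 'M[R]_(p, q)) i j : `|A i j| <= `|A|.
Proof. by rewrite [leRHS]/Num.Def.normr/= mx_normrE; exact: (le_bigmax _ _ (i, j)). Qed.

Lemma dotv_mulmx_le A (C eta : R) u v : `|A| <= C -> 0 < eta ->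
  `|dotv u (A *m v)| <= C * n%:R / 2 * (eta * dotv u u + eta^-1 * dotv v v).
Proof.
move=> AC eta0.
have C0 : 0 <= C by exact: le_trans (normr_ge0 _) AC.
have H i j : `|u i 0 * (A i j * v j 0)| <=
    C / 2 * (eta * (u i 0 * u i 0) + eta^-1 * (v j 0 * v j 0)).
  rewrite !normrM; set x := `|u i 0|; set y := `|v j 0|.
  have -> : u i 0 * u i 0 = x ^+ 2 by rewrite real_normK ?num_real// expr2.
  have -> : v j 0 * v j 0 = y ^+ 2 by rewrite real_normK ?num_real// expr2.
  have xy : 2 * (x * y) <= eta * x ^+ 2 + eta^-1 * y ^+ 2.
    rewrite -subr_ge0.
    have -> : eta * x ^+ 2 + eta^-1 * y ^+ 2 - 2 * (x * y) =
        eta^-1 * (eta * x - y) ^+ 2 by field; rewrite gt_eqF.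
    by rewrite mulr_ge0 ?sqr_ge0// invr_ge0 ltW.
  rewrite mulrCA.
  have AC' : `|A i j| <= C by exact: le_trans (mx_entry_le_norm _ _ _) AC.
  have xy0 : 0 <= x * y by exact: mulr_ge0 (normr_ge0 _) (normr_ge0 _).
  apply: le_trans (ler_wpM2r xy0 AC') _.
  have -> : C * (x * y) = C / 2 * (2 * (x * y)) by field.
  by rewrite ler_wpM2l// divr_ge0.
rewrite dotvE; apply: le_trans (ler_norm_sum _ _ _) _.
have -> : C * n%:R / 2 * (eta * dotv u u + eta^-1 * dotv v v) =
  \sum_(i < n) \sum_(j < n)
    C / 2 * (eta * (u i 0 * u i 0) + eta^-1 * (v j 0 * v j 0)).
  under eq_bigr do rewrite -mulr_sumr big_split /= sumr_const card_ord -mulr_sumr -dotvE.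
  rewrite -mulr_sumr big_split /= sumr_const card_ord sumrMnl -mulr_sumr -dotvE.
  rewrite -(mulr_natr (eta * _)) -(mulr_natr (eta^-1 * _)).
  move: (dotv u u) (dotv v v) eta^-1 (n%:R : R) => x y z N.
  by field.
apply: ler_sum => i _; rewrite mxE mulr_sumr.
apply: le_trans (ler_norm_sum _ _ _) _.
by apply: ler_sum => j _; exact: H.
Qed.

Lemma posdefmx_unit A : posdefmx A -> A \in unitmx.
Proof.
move=> pA; rewrite unitmxE unitfE; apply/negP => /det0P[v v0 vA].
have := pA v^T; rewrite trmxK vA mul0mx mxE ltxx => H.
by have := H; rewrite -(trmx0 _ _ _) (inj_eq trmx_inj) v0 => /(_ isT).
Qed.

(** The lower bound comes from expanding the form at [v - s A^-1 v]: its
    nonnegativity reads [v^T A v >= 2 s |v|^2 - s^2 v^T A^-1 v], and a small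
    enough [s] makes the right-hand side a positive multiple of [|v|^2]. *)
Lemma posdefmx_lower A : A^T = A -> posdefmx A ->
  exists2 mu : R, 0 < mu & forall v, mu * dotv v v <= dotv v (A *m v).
Proof.
move=> As pA; have Au := posdefmx_unit pA.
pose K : R := `|invmx A| * n%:R + 1.
have K0 : 0 < K by rewrite ltr_wpDl// mulr_ge0.
exists K^-1; rewrite ?invr_gt0// => v.
set w := invmx A *m v; have Aw : A *m w = v by rewrite mulmxA mulmxV// mul1mx.
have wv : dotv w v <= K * dotv v v.
  have := dotv_mulmx_le v v (lexx `|invmx A|) ltr01.
  rewrite invr1 !mul1r -/w dotvC => /(le_trans (ler_norm _)) H.
  apply: le_trans H _; have := dotvv_ge0 v; rewrite /K; lra.
have A0 x : 0 <= dotv x (A *m x).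
  have [->|x0] := eqVneq x 0; first by rewrite dotv0l.
  by rewrite -dotv_mulmxE; exact/ltW/pA.
have := A0 (v - K^-1 *: w).
rewrite mulmxBr -scalemxAr Aw dotvBl !dotvBr !(dotvZl, dotvZr).
rewrite (dotv_mulmx _ w v) As Aw.
have : K^-1 * (K^-1 * dotv w v) <= K^-1 * dotv v v.
  by rewrite ler_pM2l ?invr_gt0// ler_pdivrMl.
lra.
Qed.

End Coercivity.

Section LocalPositivity.
Context {R : realType} {k n : nat}.
Variables (a b : R) (Mdiag : 'I_k.+1 -> R -> 'M[R]_n)
  (Moff : 'I_k -> R -> 'M[R]_n).
Local Notation L := (lagrangian Mdiag Moff).
Local Notation lo i := (widen_ord (leqnSn k) i).
Local Notation hi i := (lift ord0 i).
Implicit Types q : 'I_k.+1 -> 'cV[R]_n.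

Lemma sum_dotv_shift_le q :
  \sum_(i < k) dotv (q (hi i)) (q (hi i)) <=
  \sum_(i < k) dotv (q (lo i)) (q (lo i)) + dotv (q ord_max) (q ord_max).
Proof.
have <- : \sum_i dotv (q i) (q i) = \sum_(i < k) dotv (q (lo i)) (q (lo i))
    + dotv (q ord_max) (q ord_max) by rewrite big_ord_recr.
by rewrite big_ord_recl lerDr dotvv_ge0.
Qed.

(** The products involving [q_k] are at most linear in it, so the Legendre term
    absorbs them at the cost of the lower order arguments. *)
Lemma lagrangian_lower (C mu : R) : 0 < mu -> 0 <= C ->
  exists2 C' : R, 0 <= C' & forall t,
    (forall i, `|Mdiag i t| <= C) -> (forall i, `|Moff i t| <= C) ->
    (forall v, mu * dotv v v <= dotv v (Mdiag ord_max t *m v)) ->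
    forall q, mu / 4 * dotv (q ord_max) (q ord_max)
      - C' * (\sum_(i < k) dotv (q (lo i)) (q (lo i))) <= L t q.
Proof.
move=> mu0 C0; pose kap := C * n%:R / 2.
have kap0 : 0 <= kap by rewrite !mulr_ge0// invr_ge0.
(* This weight gives half of the Legendre term [mu / 2 |q_k|^2] away to the
   products [q_i . M q_(i+1)]. *)
pose eta := 4 * kap / mu + 1.
have eta0 : 0 < eta by rewrite ltr_wpDl// divr_ge0// ?mulr_ge0 ?(ltW mu0).
have kapeta : kap * eta^-1 <= mu / 4.
  rewrite ler_pdivrMr// /eta mulrDr mulr1.
  have -> : mu / 4 * (4 * kap / mu) = kap by field; rewrite gt_eqF.
  by rewrite lerDl divr_ge0// ltW.
exists (kap + kap * eta + mu / 4) => [|t DC OC Dmu q].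
  by rewrite !addr_ge0// ?mulr_ge0// ?(ltW mu0)// ltW.
rewrite lagrangianE big_ord_recr /=.
set X := \sum_(i < k) _; set Z := dotv (q ord_max) (q ord_max).
pose Y := \sum_(i < k) dotv (q (hi i)) (q (hi i)).
have XYZ : Y <= X + Z by exact: sum_dotv_shift_le.
have H1 : - (2 * kap) * X <=
    \sum_(i < k) dotv (q (lo i)) (Mdiag (lo i) t *m q (lo i)).
  rewrite mulr_sumr; apply: ler_sum => i _.
  have := dotv_mulmx_le (q (lo i)) (q (lo i)) (DC (lo i)) ltr01.
  rewrite invr1 !mul1r -/kap ler_norml => /andP[H _].
  apply: le_trans H; lra.
have H2 : - (kap * eta) * X - mu / 4 * Y <=
    \sum_(i < k) dotv (q (lo i)) (Moff i t *m q (hi i)).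
  rewrite !mulr_sumr -sumrB; apply: ler_sum => i _.
  have := dotv_mulmx_le (q (lo i)) (q (hi i)) (OC i) eta0.
  rewrite -/kap mulrDr [kap * (eta^-1 * _)]mulrA ler_norml => /andP[H _].
  apply: le_trans H.
  have := ler_wpM2r (dotvv_ge0 (q (hi i))) kapeta; lra.
have := Dmu (q ord_max); rewrite -/Z => H3.
have : mu / 4 * Y <= mu / 4 * (X + Z) by rewrite ler_wpM2l// divr_ge0// ltW.
lra.
Qed.

Hypotheses (hab : a < b)
  (Mdiag_smooth : forall i, smooth_seg a b (Mdiag i))
  (Moff_smooth : forall i, smooth_seg a b (Moff i))
  (Mdiag_sym : (Mdiag ord_max a)^T = Mdiag ord_max a)
  (legendre : posdefmx (Mdiag ord_max a)).

(** On a short initial segment the Legendre term beats all the lower order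
    terms after adding the derivative of [N (t - a) \sum_(j < k) |h^(j)|^2],
    a quantity that vanishes at both ends for the variations of interest.  This
    plays the role of a Poincare inequality. *)
Lemma lagrangian_local_positivity :
  exists N delta : R, 0 < delta /\ forall t, a <= t <= b -> t - a <= delta ->
    forall q, 0 <= L t q + N *
      \sum_(i < k) (dotv (q (lo i)) (q (lo i))
                    + (t - a) * (2 * dotv (q (lo i)) (q (hi i)))).
Proof.
have [mu mu0 Dmu] := posdefmx_lower Mdiag_sym legendre.
have aab : a <= a <= b by rewrite lexx ltW.
have cvgM (M : R -> 'M[R]_n) : smooth_seg a b M ->
    M s @[s --> within `[a, b] (nbhs a)] --> M a.
  by move=> sM; apply: has_deriv_seg_continuous; exact: (sM 1%N 0%N a).
pose C : R := 1 + \sum_i `|Mdiag i a| + \sum_i `|Moff i a|.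
have C0 : 0 <= C by rewrite !addr_ge0// sumr_ge0.
have mu20 : 0 < mu / 2 by rewrite divr_gt0.
have D0 : 0 <= \sum_i `|Mdiag i a| by exact: sumr_ge0.
have O0 : 0 <= \sum_i `|Moff i a| by exact: sumr_ge0.
have CD i : 1 + `|Mdiag i a| <= C.
  rewrite /C -addrA lerD2l (bigD1 i)//= -addrA lerDl.
  by rewrite addr_ge0// sumr_ge0.
have CO i : 1 + `|Moff i a| <= C.
  suff : `|Moff i a| <= \sum_i `|Moff i a| by rewrite /C; lra.
  by rewrite (bigD1 i)//= lerDl sumr_ge0.
have [C' C'0 lowL] := lagrangian_lower mu20 C0.
pose e := mu / (2 * n.+1%:R).
have e0 : 0 < e by rewrite divr_gt0// mulr_gt0.
have nearD : \forall t \near within `[a, b] (nbhs a),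
    forall i : 'I_k.+1, `|Mdiag i a - Mdiag i t| <= 1.
  apply: filter_forall => i.
  by have /cvgrPdist_le/(_ 1 ltr01) := cvgM _ (@Mdiag_smooth i).
have nearO : \forall t \near within `[a, b] (nbhs a),
    forall i : 'I_k, `|Moff i a - Moff i t| <= 1.
  apply: filter_forall => i.
  by have /cvgrPdist_le/(_ 1 ltr01) := cvgM _ (@Moff_smooth i).
have nearK : \forall t \near within `[a, b] (nbhs a),
    `|Mdiag ord_max a - Mdiag ord_max t| <= e.
  by have /cvgrPdist_le/(_ e e0) := cvgM _ (@Mdiag_smooth ord_max).
have near_bound (M M' : 'M[R]_n) c : `|M - M'| <= 1 -> `|M| <= c -> `|M'| <= 1 + c.
  move=> MM' Mc; have -> : M' = - (M - M') + M by rewrite opprB subrK.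
  by apply: le_trans (ler_normD _ _) _; rewrite normrN lerD.
have [d /= d0 dP] := filterI (filterI nearD nearO) nearK.
(* With [th = t - a], [N] times the sum is at least
   [N ((1 - 2 th) X - th Z)]: [N] is taken so that half of [N X] pays for
   [C' X], and then [th] so small that [N th] is below the coefficient of [Z]. *)
pose N := 2 * C'.
exists N, (Num.min (d / 2) (Num.min 4^-1 (mu / 8 / (N + 1)))).
have N0 : 0 <= N by rewrite mulr_ge0.
have N1 : 0 < N + 1 by rewrite ltr_wpDl.
split=> [|t tab].
  by rewrite !lt_min !divr_gt0// invr_gt0 ltr0Sn.
rewrite !le_min => /and3P[td t4]; rewrite ler_pdivlMr// => tN q.
have [at_ tb] := andP tab.
have [||[DC OC] KC] := dP t.
- by rewrite /= ltr_distlC; apply/andP; split; lra.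
- by rewrite /= in_itv.
have {lowL} := lowL t _ _ _ q.
set X := \sum_(i < k) _; set Z := dotv (q ord_max) (q ord_max) => lowL.
pose Y := \sum_(i < k) dotv (q (hi i)) (q (hi i)).
have XYZ : Y <= X + Z by exact: sum_dotv_shift_le.
have X0 : 0 <= X by apply: sumr_ge0 => i _; exact: dotvv_ge0.
have Z0 : 0 <= Z by exact: dotvv_ge0.
have {lowL}H1 : mu / 8 * Z - C' * X <= L t q.
  have -> : mu / 8 = mu / 2 / 4 by field.
  apply: lowL => [i|i|v].
  - exact: le_trans (near_bound _ _ _ (DC i) (lexx _)) (CD i).
  - exact: le_trans (near_bound _ _ _ (OC i) (lexx _)) (CO i).
  - have := dotv_mulmx_le v v KC ltr01.
    rewrite invr1 !mul1r ler_norml mulmxBl dotvBr => /andP[_ H].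
    have := Dmu v; have v0 := dotvv_ge0 v.
    have : e * n%:R / 2 * (dotv v v + dotv v v) <= mu / 2 * dotv v v.
      have -> : e * n%:R / 2 * (dotv v v + dotv v v) =
          (e * n%:R) * dotv v v by field.
      rewrite ler_wpM2r// /e invfM mulrA -mulrA ler_piMr ?(ltW mu20)//.
      by rewrite mulrC ler_pdivrMr// mul1r ler_nat.
    lra.
pose th := t - a; have th0 : 0 <= th by rewrite subr_ge0.
have H2 : X - th * (X + Y) <= \sum_(i < k) (dotv (q (lo i)) (q (lo i))
    + th * (2 * dotv (q (lo i)) (q (hi i)))).
  rewrite /X /Y -big_split /= mulr_sumr -sumrB; apply: ler_sum => i _.
  rewrite -mulrN lerD2l ler_wpM2l//.
  have := dotvv_ge0 (q (lo i) + q (hi i)).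
  rewrite !(dotvDl, dotvDr) (dotvC (q (hi i)) (q (lo i))); lra.
have H3 : N * (X - th * (X + Y)) >= C' * X - mu / 8 * Z.
  have : th * Y <= th * (X + Z) by rewrite ler_wpM2l.
  have : N * th * Z <= mu / 8 * Z.
    rewrite ler_wpM2r//; apply: le_trans tN; rewrite mulrC ler_wpM2l//.
    by rewrite lerDl.
  have : th * X <= 4^-1 * X by rewrite ler_wpM2r.
  rewrite -/th in t4 tN *.
  move=> h1 h2 h3.
  have : N * (th * Y) <= N * (th * (X + Z)) by rewrite ler_wpM2l.
  have : N * (th * X) <= N * (4^-1 * X) by rewrite ler_wpM2l.
  rewrite /N in h2 *; lra.
have := ler_wpM2l N0 H2; lra.
Qed.

End LocalPositivity.

(** * The field of extremals issuing from the left end point *)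

Section JetRow.
Context {R : realType} {k n : nat}.
Implicit Types f g : nat -> 'cV[R]_n.

Definition jet_row f : 'rV[R]_(k * n) := mxvec (\matrix_(j < k) (f j)^T).

Lemma jet_row_eq f g : (forall j, (j < k)%N -> f j = g j) ->
  jet_row f = jet_row g.
Proof.
by move=> fg; congr mxvec; apply/row_matrixP => j; rewrite !rowK fg.
Qed.

Lemma jet_row_inj f g : jet_row f = jet_row g ->
  forall j, (j < k)%N -> f j = g j.
Proof.
move=> /(can_inj mxvecK) fg j jk; apply: trmx_inj.
by have := congr1 (row (Ordinal jk)) fg; rewrite !rowK.
Qed.

Lemma jet_row0 : jet_row (fun=> 0) = 0.
Proof.
rewrite -[RHS](linear0 mxvec); congr mxvec.
by apply/row_matrixP => j; rewrite rowK trmx0 row0.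
Qed.

Lemma mulmx_jet_row m (c : 'rV[R]_m) (F : 'I_m -> nat -> 'cV[R]_n) :
  c *m \matrix_i jet_row (F i) = jet_row (fun j => \sum_i c 0 i *: F i j).
Proof.
rewrite mulmx_sum_row; under eq_bigr do rewrite rowK -linearZ.
rewrite -linear_sum; congr mxvec; apply/row_matrixP => j.
rewrite rowK linear_sum /= linear_sum /=; apply: eq_bigr => i _.
by rewrite !linearZ /= rowK.
Qed.

End JetRow.

Section JacobiField.
Context {R : realType} {k n : nat}.
Variables (a b : R) (Mdiag : 'I_k.+1 -> R -> 'M[R]_n)
  (Moff : 'I_k -> R -> 'M[R]_n) (hs : 'I_(k * n) -> R -> 'cV[R]_n).
Hypotheses (hab : a < b) (hk : (1 <= k)%N)
  (Mdiag_smooth : forall i, smooth_seg a b (Mdiag i))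
  (Moff_smooth : forall i, smooth_seg a b (Moff i))
  (Mdiag_sym : forall i t, a <= t <= b -> (Mdiag i t)^T = Mdiag i t)
  (strong_legendre : forall t, a <= t <= b -> posdefmx (Mdiag ord_max t))
  (hs_sol : forall i, jacobi_solution a b Mdiag Moff (hs i))
  (hs_init : forall i j, (j < k)%N -> derivn_seg a b j (hs i) a = 0)
  (no_conjugate : forall t, a < t <= b -> ~ conjugate_point a b hs t).

Local Notation has_deriv_seg := (has_deriv_seg a b).
Local Notation D := (derivn_seg a b).
Local Notation L := (lagrangian Mdiag Moff).
Local Notation B := (lag_polar Mdiag Moff).
Local Notation J := (@jet R k n a b).
Local Notation pairing := (momentum_pairing a b Mdiag Moff).
Local Notation lo i := (widen_ord (leqnSn k) i).

Let hs_derivable i : derivablen_seg a b (2 * k) (hs i).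
Proof. by have [] := hs_sol i. Qed.

Let le_k_2k : (k <= 2 * k)%N. Proof. by rewrite mul2n -addnn leq_addr. Qed.

Lemma pairing_hs_has_deriv i u t : derivablen_seg a b k u -> a <= t <= b ->
  has_deriv_seg (pairing (hs i) u) t (B t (J (hs i) t) (J u t)).
Proof. by move=> du tab; exact: momentum_pairing_has_deriv. Qed.

Lemma pairing_lin h u (c : 'I_(k * n) -> R) t :
  (forall j, (j < k)%N -> D j u t = \sum_i c i *: D j (hs i) t) ->
  pairing h u t = \sum_i c i * pairing h (hs i) t.
Proof.
move=> uc; rewrite /momentum_pairing; under [RHS]eq_bigr do rewrite mulr_sumr.
rewrite exchange_big /=; apply: eq_bigr => j _; rewrite uc// dotv_sumr.
by apply: eq_bigr => i _; rewrite dotvZr.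
Qed.

Lemma pairing0 h u t : (forall j, (j < k)%N -> D j u t = 0) ->
  pairing h u t = 0.
Proof. by move=> u0; apply: big1 => j _; rewrite u0// dotv0r. Qed.

(** Both pairings vanish at [a] and have the same derivative, the polar form of
    the Lagrangian being symmetric: the solutions span a Lagrangian plane. *)
Lemma pairing_hs_sym i j t : a <= t <= b ->
  pairing (hs i) (hs j) t = pairing (hs j) (hs i) t.
Proof.
move=> /andP[at_ tb]; apply/eqP; rewrite -subr_eq0 eq_sym; apply/eqP.
pose w s := pairing (hs i) (hs j) s - pairing (hs j) (hs i) s.
have <- : w a = 0 by rewrite /w !pairing0 ?subrr// => l lk; exact: hs_init.
rewrite -[RHS]/(w t).
apply: (has_deriv_seg0_eq (b := b) (f := w) (lexx a)) => // s /andP[as_ st].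
have sab : a <= s <= b by rewrite as_ (le_trans st).
have dh l := derivablen_seg_le le_k_2k (@hs_derivable l).
rewrite -[0](subrr (B s (J (hs i) s) (J (hs j) s))).
apply: (@has_deriv_segB _ _ _ R^o); first exact: pairing_hs_has_deriv (dh _) sab.
rewrite lag_polarC => [|l]; first exact: pairing_hs_has_deriv (dh _) sab.
exact: Mdiag_sym.
Qed.

Lemma lagrangian_jet_derivable h t : derivablen_seg a b k.+1 h ->
  a <= t <= b -> derivable_seg a b (fun s => L s (J h s)) t.
Proof.
move=> dh tab; apply: has_deriv_seg_derivable.
have jetD (i : 'I_k.+1) : derivablen_seg a b 1 (fun s => J h s i).
  by apply: derivablen_seg_derivn; apply: derivablen_seg_le dh.
have formD (M : R -> 'M[R]_n) (i j : 'I_k.+1) : smooth_seg a b M ->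
    has_deriv_seg (fun s => ((J h s i)^T *m M s *m J h s j) 0 0) t
      (deriv_seg a b (fun s => (J h s i)^T *m M s *m J h s j) t 0 0).
  move=> sM; have F : derivablen_seg a b 1 (fun s => (J h s i)^T *m M s *m J h s j).
    apply: derivablen_seg_mulmx => //; apply: derivablen_seg_mulmx => //.
    exact: derivablen_seg_trmx.
  by have /has_deriv_seg_mxP/(_ 0 0) := F 0%N t isT tab.
rewrite /lagrangian; apply: (@has_deriv_segD _ _ _ R^o).
  apply: (@has_deriv_segZ _ _ _ R^o); apply: (@has_deriv_seg_sum _ _ _ R^o).
  by move=> i _; apply: formD; exact: Mdiag_smooth.
apply: (@has_deriv_seg_sum _ _ _ R^o).
by move=> i _; apply: formD; exact: Moff_smooth.
Qed.

Definition wronskian_mx (t : R) : 'M[R]_(k * n) :=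
  \matrix_i jet_row (fun j => D j (hs i) t).

(** Cramer's rule, defined for all [t] and visibly differentiable wherever the
    Wronskian does not vanish. *)
Definition field_coef (h : R -> 'cV[R]_n) (t : R) : 'rV[R]_(k * n) :=
  (\det (wronskian_mx t))^-1 *: (jet_row (fun j => D j h t) *m \adj (wronskian_mx t)).

Lemma wronskian_mx_det_neq0 t : a < t <= b -> \det (wronskian_mx t) != 0.
Proof. by move=> tab; apply/eqP => W0; apply: (no_conjugate tab). Qed.

(** The identity extends to [t = a], where both sides are zero whatever the
    coefficients are, so that it may be differentiated within the whole segment. *)
Lemma field_coefP h t j : (forall j, (j < k)%N -> D j h a = 0) ->
  a <= t <= b -> (j < k)%N ->
  D j h t = \sum_i field_coef h t 0 i *: D j (hs i) t.
Proof.
move=> h0 /andP[at_ tb]; apply: (@jet_row_inj _ _ _ (fun j => D j h t)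
  (fun j => \sum_i field_coef h t 0 i *: D j (hs i) t)).
rewrite -mulmx_jet_row -/(wronskian_mx t).
move: at_; rewrite le_eqVlt => /predU1P[<-|at_]; last first.
  rewrite /field_coef -scalemxAl -mulmxA mul_adj_mx mul_mx_scalar scalerA.
  by rewrite mulVf ?scale1r// wronskian_mx_det_neq0// at_.
have -> : wronskian_mx a = 0.
  apply/row_matrixP => i; rewrite rowK row0 -jet_row0.
  by apply: jet_row_eq => l lk; exact: hs_init.
by rewrite mulmx0 -jet_row0; apply: jet_row_eq.
Qed.

Lemma field_coef_derivable h t i : derivablen_seg a b k h -> a < t <= b ->
  derivable_seg a b (fun s => field_coef h s 0 i) t.
Proof.
move=> dh tab; have tab' : a <= t <= b by case/andP: tab => /ltW-> ->.
have rowD (u : R -> 'cV[R]_n) l : derivablen_seg a b k u ->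
    derivable_seg a b (fun s => jet_row (k := k) (fun j => D j u s) 0 l) t.
  move=> du; case/mxvec_indexP: l => j m.
  under eq_fun do rewrite mxvecE !mxE.
  have /has_deriv_seg_mxP/(_ m 0) := derivablen_seg_has_deriv du (ltn_ord j) tab'.
  exact: has_deriv_seg_derivable.
have WD l m : derivable_seg a b (fun s => wronskian_mx s l m) t.
  under eq_fun do rewrite mxE; apply: rowD.
  exact: derivablen_seg_le le_k_2k (@hs_derivable l).
under eq_fun do rewrite mxE [X in _ * X]mxE.
apply: has_deriv_seg_derivable; apply: has_deriv_segM.
  apply: has_deriv_segV; first exact: wronskian_mx_det_neq0.
  by apply: derivable_seg_deriv; exact: derivable_seg_det.
apply: (@has_deriv_seg_sum _ _ _ R^o) => l _; apply: has_deriv_segM.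
  by apply: derivable_seg_deriv; exact: rowD.
by apply: derivable_seg_deriv; exact: derivable_seg_adj.
Qed.

(** With the coefficients frozen at [t] the field is a Jacobi solution having
    the same [k]-jet as [h]; the excess is what remains of [h^(k)]. *)
Definition field_excess (h : R -> 'cV[R]_n) (t : R) : 'cV[R]_n :=
  D k h t - \sum_i field_coef h t 0 i *: D k (hs i) t.

(** Differentiate [h^(j) = \sum_i c_i h_i^(j)] and subtract the same identity at
    order [j.+1], which is available only as long as [j.+1 < k]. *)
Lemma field_coef_deriv_jet h t j : derivablen_seg a b k h ->
  (forall j, (j < k)%N -> D j h a = 0) -> a < t <= b -> (j < k)%N ->
  \sum_i deriv_seg a b (fun s => field_coef h s 0 i) t *: D j (hs i) t =
  if j.+1 == k then field_excess h t else 0.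
Proof.
move=> dh h0 tab jk; have tab' : a <= t <= b by case/andP: tab => /ltW-> ->.
pose c i s := field_coef h s 0 i.
have H : D j.+1 h t =
    \sum_i (deriv_seg a b (c i) t *: D j (hs i) t + c i t *: D j.+1 (hs i) t).
  apply: has_deriv_seg_deriv => //.
  apply: (has_deriv_seg_eq (f := fun s => \sum_i c i s *: D j (hs i) s)) => //.
    by move=> s sab; rewrite -field_coefP.
  apply: has_deriv_seg_sum => i _; apply: has_deriv_seg_scale.
    exact: field_coef_derivable.
  apply: (derivablen_seg_has_deriv (@hs_derivable i)) => //.
  exact: leq_trans jk le_k_2k.
move: H; rewrite big_split => /eqP; rewrite -subr_eq => /eqP <-.
case: eqP => [->//|/eqP jk'].
by rewrite field_coefP ?subrr// ltn_neqAle jk'.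
Qed.

Lemma field_coef_deriv0 h t i : derivablen_seg a b k h ->
  (forall j, (j < k)%N -> D j h a = 0) -> a < t <= b ->
  field_excess h t = 0 -> deriv_seg a b (fun s => field_coef h s 0 i) t = 0.
Proof.
move=> dh h0 tab v0.
pose dc : 'rV[R]_(k * n) :=
  \row_i deriv_seg a b (fun s => field_coef h s 0 i) t.
have : dc *m wronskian_mx t = 0.
  rewrite mulmx_jet_row -jet_row0; apply: jet_row_eq => j jk.
  under eq_bigr do rewrite mxE.
  by rewrite field_coef_deriv_jet// v0 if_same.
have Wu : wronskian_mx t \in unitmx by rewrite unitmxE unitfE wronskian_mx_det_neq0.
move=> /(congr1 (mulmx^~ (invmx (wronskian_mx t)))).
by rewrite mulmxK// mul0mx => /rowP/(_ i); rewrite !mxE.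
Qed.

Definition field_action (h : R -> 'cV[R]_n) (t : R) : R :=
  2^-1 * \sum_i field_coef h t 0 i * pairing (hs i) h t.

(** Completing the square: away from [a] the Lagrangian is the derivative of
    the action of the field plus a square weighted by the Legendre matrix. *)
Lemma field_action_has_deriv h t : derivablen_seg a b k h ->
  (forall j, (j < k)%N -> D j h a = 0) -> a < t <= b ->
  has_deriv_seg (field_action h) t
    (L t (J h t) - 2^-1 * dotv (field_excess h t)
                            (Mdiag ord_max t *m field_excess h t)).
Proof.
move=> dh h0 tab; have tab' : a <= t <= b by case/andP: tab => /ltW-> ->.
have sym i : (Mdiag i t)^T = Mdiag i t by exact: Mdiag_sym.
pose c i := field_coef h t 0 i.
pose dc i := deriv_seg a b (fun s => field_coef h s 0 i) t.
pose v := field_excess h t.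
pose g (j : 'I_k.+1) := \sum_i c i *: J (hs i) t j.
pose r (j : 'I_k.+1) := J h t j - g j.
have r_lo i : r (lo i) = 0 by rewrite /r /g /jet /= -field_coefP ?subrr.
have r_top : r ord_max = v by [].
have Jh : J h t = (fun j => g j + 1 *: r j).
  by apply/funext => j; rewrite scale1r addrC subrK.
have Bgr : B t g r = \sum_i c i * dotv (momentum a b Mdiag Moff (hs i) k t) v.
  rewrite lag_polar_suml//; apply: eq_bigr => i _.
  by rewrite lag_polar_top// momentum_top.
have Bgh : \sum_i c i * B t (J (hs i) t) (J h t) = 2 * L t g + B t g r.
  rewrite -lag_polar_suml// -/g -lag_polar_diag// {1}Jh /lag_polar -big_split /=.
  by apply: eq_bigr => j _; rewrite scale1r dotvDr.
(* By symmetry of the pairings the derivative of the coefficients acts on the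
   jets, where it only leaves the excess in position [k.-1]. *)
have Kdc : \sum_i dc i * pairing (hs i) h t = B t g r.
  rewrite Bgr; transitivity (\sum_j \sum_i dc j * (c i * pairing (hs i) (hs j) t)).
    apply: eq_bigr => j _; rewrite (pairing_lin _ (c := c)) => [|l lk].
      rewrite mulr_sumr; apply: eq_bigr => i _.
      by rewrite pairing_hs_sym.
    exact: field_coefP.
  rewrite exchange_big /=; apply: eq_bigr => i _.
  under eq_bigr do rewrite mulrCA; rewrite -mulr_sumr; congr (_ * _).
  rewrite /momentum_pairing; under eq_bigr do rewrite mulr_sumr.
  rewrite exchange_big /=.
  pose p l := momentum a b Mdiag Moff (hs i) l t.
  have E (l : 'I_k) : \sum_j dc j * dotv (p l.+1) (D l (hs j) t)
      = dotv (p l.+1) (if l.+1 == k then v else 0).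
    rewrite -field_coef_deriv_jet// dotv_sumr.
    by apply: eq_bigr => j _; rewrite dotvZr.
  under eq_bigr do rewrite E.
  have k1k : (k.-1 < k)%N by rewrite prednK.
  rewrite (bigD1 (Ordinal k1k))//= prednK// eqxx big1 ?addr0// => l lk.
  case: eqP => [lk'|_]; last by rewrite dotv0r.
  by move: lk; rewrite -val_eqE /= => /eqP[]; apply: succn_inj; rewrite prednK.
have -> : L t (J h t) - 2^-1 * dotv v (Mdiag ord_max t *m v) =
    2^-1 * \sum_i (dc i * pairing (hs i) h t + c i * B t (J (hs i) t) (J h t)).
  rewrite big_split /= Kdc Bgh Jh lagrangian_expand// (lagrangian_top _ _ _ r_lo) r_top.
  by rewrite expr1n; field.
apply: (@has_deriv_segZ _ _ _ R^o); apply: (@has_deriv_seg_sum _ _ _ R^o) => i _.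
apply: has_deriv_segM; first exact: field_coef_derivable.
exact: pairing_hs_has_deriv.
Qed.

(** Near [a] the Legendre condition alone makes the frozen field minimising
    among the curves with the same end data, so the integral of the Lagrangian
    up to [t], written here with a primitive [F], dominates the action. *)
Lemma field_action_near_le h F : derivablen_seg a b k.+1 h ->
  (forall j, (j < k)%N -> D j h a = 0) ->
  (forall t, a <= t <= b -> has_deriv_seg F t (L t (J h t))) ->
  exists2 delta, 0 < delta & forall t, a <= t <= b -> t - a <= delta ->
    field_action h t <= F t - F a.
Proof.
move=> dh1 h0 FD; have dh := derivablen_seg_le (leqnSn k) dh1.
have aab : a <= a <= b by rewrite lexx ltW.
have [N [d [d0 pos]]] := lagrangian_local_positivity hab Mdiag_smooth
  Moff_smooth (Mdiag_sym ord_max aab) (strong_legendre aab).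
exists d => // t tab td; have [at_ tb] := andP tab.
pose c i := field_coef h t 0 i.
pose u j s := D j h s - \sum_i c i *: D j (hs i) s.
pose S i j s := pairing (hs i) (hs j) s.
(* Along [u = h - \sum_i c_i h_i] the Lagrangian is
   [L(h) - \sum_i c_i B(h_i, h) + 1/2 \sum_(i, j) c_i c_j B(h_i, h_j)], of which
   the first three terms of [Phi] form a primitive. *)
pose Phi s := F s - \sum_i c i * pairing (hs i) h s
  + 2^-1 * (\sum_i c i * \sum_j c j * S i j s)
  + N * \sum_(j < k) (s - a) * dotv (u j s) (u j s).
have uD j s : (j < k)%N -> a <= s <= b -> has_deriv_seg (u j) s (u j.+1 s).
  move=> jk sab; apply: has_deriv_segB.
    exact: derivablen_seg_has_deriv dh _ _.
  apply: has_deriv_seg_sum => i _; apply: has_deriv_segZ.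
  by apply: (derivablen_seg_has_deriv (@hs_derivable i)) => //; exact: leq_trans le_k_2k.
pose dPhi s := L s (J h s) - \sum_i c i * B s (J (hs i) s) (J h s)
  + 2^-1 * (\sum_i c i * \sum_j c j * B s (J (hs i) s) (J (hs j) s))
  + N * \sum_(j < k) (dotv (u j s) (u j s) + (s - a) * (2 * dotv (u j s) (u j.+1 s))).
have PhiD s : a <= s <= b -> has_deriv_seg Phi s (dPhi s).
  move=> sab; rewrite /Phi /dPhi /S; apply: (@has_deriv_segD _ _ _ R^o).
    apply: (@has_deriv_segD _ _ _ R^o).
      apply: (@has_deriv_segB _ _ _ R^o); first exact: FD.
      apply: (@has_deriv_seg_sum _ _ _ R^o) => i _.
      by apply: (@has_deriv_segZ _ _ _ R^o); exact: pairing_hs_has_deriv.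
    apply: (@has_deriv_segZ _ _ _ R^o).
    apply: (@has_deriv_seg_sum _ _ _ R^o) => i _.
    apply: (@has_deriv_segZ _ _ _ R^o).
    apply: (@has_deriv_seg_sum _ _ _ R^o) => j _.
    apply: (@has_deriv_segZ _ _ _ R^o).
    exact: pairing_hs_has_deriv (derivablen_seg_le le_k_2k (@hs_derivable j)) sab.
  apply: (@has_deriv_segZ _ _ _ R^o).
  apply: (@has_deriv_seg_sum _ _ _ R^o) => j _.
  have UD := uD j s (ltn_ord j) sab.
  have /has_deriv_seg_mxP/(_ 0 0) :=
    has_deriv_seg_mulmx (has_deriv_seg_trmx UD) UD.
  rewrite mxE -!/(dotv _ _) (dotvC (u j.+1 s)) => UU.
  have ID : has_deriv_seg (fun s => s - a) s (1 - 0).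
    apply: (@has_deriv_segB _ _ _ R^o); first exact: has_deriv_seg_id.
    exact: (@has_deriv_seg_cst _ _ _ R^o).
  have := has_deriv_segM ID UU; rewrite subr0 mul1r.
  by have -> x : x + x = 2 * x :> R by ring.
have dPhi_ge0 s : a <= s <= t -> 0 <= dPhi s.
  move=> /andP[as_ st]; have sab : a <= s <= b by rewrite as_ (le_trans st).
  have sym i : (Mdiag i s)^T = Mdiag i s by exact: Mdiag_sym.
  pose g (j : 'I_k.+1) := \sum_i c i *: J (hs i) s j.
  pose w (j : 'I_k.+1) := J h s j + -1 *: g j.
  have := pos s sab _ w; rewrite {1}/w.
  rewrite lagrangian_expand// sqrrN expr1n !mul1r mulN1r.
  rewrite lag_polarC// lag_polar_suml//.
  have -> : L s g = 2^-1 * B s g g by rewrite lag_polar_diag//; field.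
  have -> : B s g g = \sum_i c i * \sum_j c j * B s (J (hs i) s) (J (hs j) s).
    rewrite lag_polar_suml//; apply: eq_bigr => i _.
    by rewrite lag_polar_sumr.
  rewrite /dPhi => pos'; apply: (le_trans (pos' _)); first by lra.
  rewrite lerD2l.
  suff -> : \sum_(j < k) (dotv (u j s) (u j s)
        + (s - a) * (2 * dotv (u j s) (u j.+1 s))) =
      \sum_(i < k) (dotv (w (lo i)) (w (lo i))
        + (s - a) * (2 * dotv (w (lo i)) (w (lift ord0 i)))) by [].
  by apply: eq_bigr => j _; rewrite /w !scaleN1r.
have PhiD' s : a <= s <= t -> has_deriv_seg Phi s (dPhi s).
  by move=> /andP[as_ st]; apply: PhiD; rewrite as_ (le_trans st).
have := has_deriv_seg_le (lexx a) at_ tb PhiD' dPhi_ge0.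
have -> : Phi a = F a.
  rewrite /Phi !big1 ?subr0 ?mulr0 ?addr0// => i _.
  - by rewrite subrr mul0r.
  - rewrite big1 ?mulr0// => j _.
    by rewrite /S pairing0 ?mulr0// => l lk; exact: hs_init.
  - by rewrite pairing0 ?mulr0.
have -> : Phi t = F t - field_action h t.
  rewrite /Phi /field_action [X in _ + N * X]big1 => [|j _]; last first.
    by rewrite /u /c -field_coefP// subrr dotv0l mulr0.
  have -> : \sum_i c i * (\sum_j c j * S i j t) = \sum_i c i * pairing (hs i) h t.
    apply: eq_bigr => i _; congr (_ * _); rewrite (pairing_lin _ (c := c))// => l lk.
    exact: field_coefP.
  by rewrite mulr0 addr0 -/c; set x := \sum_i _; field.
lra.
Qed.

End JacobiField.

(** * Positive definiteness *)

Unset Implicit Arguments.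

Theorem theorem4p3 (R : realType) (a b : R) (k n : nat)
  (Mdiag : 'I_k.+1 -> R -> 'M[R]_n) (Moff : 'I_k -> R -> 'M[R]_n)
  (hs : 'I_(k * n) -> R -> 'cV[R]_n)
  (hab : a < b) (hk : (1 <= k)%N) (hn : (1 <= n)%N)
  (Mdiag_smooth : forall i, smooth_seg a b (Mdiag i))
  (Moff_smooth : forall i, smooth_seg a b (Moff i))
  (Mdiag_sym : forall i t, a <= t <= b -> (Mdiag i t)^T = Mdiag i t)
  (strong_legendre : forall t, a <= t <= b -> posdefmx (Mdiag ord_max t))
  (hs_sol : forall i, jacobi_solution a b Mdiag Moff (hs i))
  (hs_indep : lin_indep_seg a b hs)
  (hs_init : forall i j, (j < k)%N -> derivn_seg a b j (hs i) a = 0)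
  (no_conjugate : forall t, a < t <= b -> ~ conjugate_point a b hs t) :
  positive_definiteQ a b Mdiag Moff.
Proof.
move=> h [smooth_h bc].
have h0 j : (j < k)%N -> derivn_seg a b j h a = 0 by move=> /bc[].
have hb j : (j < k)%N -> derivn_seg a b j h b = 0 by move=> /bc[].
have dh1 : derivablen_seg a b k.+1 h by exact: smooth_h.
have dh : derivablen_seg a b k h by exact: smooth_h.
have [F FD FQ] := continuous_seg_primitive hab
  (fun t tab => has_deriv_seg_continuous
    (lagrangian_jet_derivable hab Mdiag_smooth Moff_smooth dh1 tab)).
rewrite /functionalQ FQ.
have [d d0 near_a] := field_action_near_le hab Mdiag_smooth Moff_smooth
  Mdiag_sym strong_legendre hs_sol hs_init no_conjugate dh1 h0 FD.
pose A := field_action a b Mdiag Moff hs h.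
pose v t := field_excess a b hs h t.
have Ab : A b = 0.
  by rewrite /A /field_action big1 ?mulr0// => i _; rewrite pairing0// mulr0.
have FAD t : a < t <= b -> has_deriv_seg a b (fun s => F s - A s) t
    (2^-1 * dotv (v t) (Mdiag ord_max t *m v t)).
  move=> tab; have tab' : a <= t <= b by case/andP: tab => /ltW-> ->.
  have AD := field_action_has_deriv hab hk Mdiag_smooth Moff_smooth Mdiag_sym
    hs_sol hs_init no_conjugate dh h0 tab.
  by have := has_deriv_segB (FD t tab') AD; rewrite opprB addrC subrK.
have FA_le x y : a < x -> x <= y -> y <= b -> F x - A x <= F y - A y.
  move=> ax xy yb.
  have tab t : x <= t <= y -> a < t <= b.
    by move=> /andP[xt ty]; rewrite (lt_le_trans ax) ?(le_trans ty).
  apply: (has_deriv_seg_le (ltW ax) xy yb (fun t txy => FAD t (tab t txy))).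
  move=> t /tab /andP[/ltW at_ tb]; rewrite mulr_ge0 ?invr_ge0//.
  have [->|v0] := eqVneq (v t) 0; first by rewrite dotv0l.
  by rewrite -dotv_mulmxE ltW// strong_legendre ?at_.
have Fa_le x : a < x -> x <= b -> x - a <= d -> F a <= F x - A x.
  move=> ax xb xd; have := near_a x _ xd; rewrite (ltW ax) xb -/(A x) => /(_ isT).
  lra.
split=> [|Q0 t /andP[at_ tb]].
  pose x := Num.min b (a + d).
  have ax : a < x by rewrite lt_min hab ltrDl.
  have xb : x <= b by rewrite ge_min lexx.
  have xd : x - a <= d by rewrite lerBlDl ge_min lexx orbT.
  have := Fa_le x ax xb xd; have := FA_le x b ax xb (lexx b); lra.
move: at_; rewrite le_eqVlt => /predU1P[<-|at_]; first exact: (h0 0%N).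
move: tb; rewrite le_eqVlt => /predU1P[->|tb]; first exact: (hb 0%N).
pose x := Num.min t (a + d).
have ax : a < x by rewrite lt_min at_ ltrDl.
have xt : x <= t by rewrite ge_min lexx.
have xb : x < b := le_lt_trans xt tb.
have xd : x - a <= d by rewrite lerBlDl ge_min lexx orbT.
have FA_cst s : x <= s <= b -> F s - A s = F b.
  move=> /andP[xs sb]; have := Fa_le x ax (ltW xb) xd.
  have := FA_le x s ax xs sb; have := FA_le s b (lt_le_trans ax xs) sb (lexx b).
  by move=> *; apply/eqP; rewrite eq_le; apply/andP; split; lra.
have sab s : x <= s <= b -> a < s <= b.
  by move=> /andP[xs ->]; rewrite (lt_le_trans ax).
have v_eq0 s : x <= s <= b -> v s = 0.
  move=> sxb; have /andP[as_ sb] := sab s sxb.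
  have := has_deriv_seg_const (ltW ax) xb (lexx b) sxb FA_cst (FAD s (sab s sxb)).
  move=> /eqP; rewrite mulf_eq0 invr_eq0 pnatr_eq0 /= -dotv_mulmxE => vMv.
  apply/eqP; apply: contraTT vMv => v0.
  by rewrite gt_eqF// strong_legendre ?(ltW as_).
have c_cst i : field_coef a b hs h t 0 i = field_coef a b hs h b 0 i.
  apply: (has_deriv_seg0_eq (b := b) (f := fun s => field_coef a b hs h s 0 i)
    (ltW at_) (ltW tb) (lexx b)) => s /andP[ts sb].
  have sxb : x <= s <= b by rewrite (le_trans xt ts) sb.
  have := field_coef_derivable hs_sol no_conjugate (i := i) dh (sab s sxb).
  move=> /derivable_seg_deriv.
  by rewrite (field_coef_deriv0 hab hs_sol hs_init no_conjugate)//;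
    [exact: sab|exact: v_eq0].
have c_b i : field_coef a b hs h b 0 i = 0.
  rewrite /field_coef (_ : jet_row _ = 0) ?mul0mx ?scaler0 ?mxE//.
  by rewrite -jet_row0; apply: jet_row_eq => j jk; rewrite hb.
rewrite -[h t]/(derivn_seg a b 0 h t).
rewrite (field_coefP hs_init no_conjugate h0)// ?(ltW at_) ?(ltW tb)//.
by rewrite big1// => i _; rewrite c_cst c_b scale0r.
Qed.
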